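(* Let $T>0$ and $\Omega=(0,T)\times(0,1)$. Let $H:[0,1]\times\mathbb{R}\to\mathbb{R}$ satisfy $H\in C^1([0,1]\times\mathbb{R})$, $D_pH\in C^1([0,1]\times\mathbb{R})$, and, for every $x\in[0,1]$, $\lim_{|p|\to\infty}H(x,p)/|p|=+\infty$ and $D_{pp}H(x,p)>0$ for all $p\in\mathbb{R}$. Let $m_0,m_T\in C^1([0,1])$ be strictly positive on $[0,1]$ with $\int_0^1 m_0\,dx=\int_0^1 m_T\,dx=1$. Consider the ranking planning problem (P1) and the associated problem (P2) stated in the context, and the relations $$(\ast)\quad\begin{cases} m(t,x)=\varphi_x(t,x),\\[1mm] u(t,x)=-\displaystyle\int_0^xF_j\big(y,-\varphi_t(t,y),\varphi_x(t,y)\big)\,dy-\int_0^tF_m\big(0,-\varphi_t(s,0),\varphi_x(s,0)\big)\,ds.\end{cases}$$ 1. If $\varphi\in C^2(\overline\Omega)$ is a classical solution of (P2) with $\varphi_x>0$ on $\overline\Omega$, then the pair $(u,m)$ defined by $(\ast)$ is a classical solution of (P1). 2. Conversely, if $(u,m)\in C^2(\overline\Omega)\times C^1(\overline\Omega)$ is a classical solution of (P1) with $m>0$ on $\overline\Omega$ and $u(0,0)=0$, then there exists a function $\varphi\in C^2(\overline\Omega)$ satisfying $(\ast)$ that solves (P2).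
   Context: Points of $\Omega$ are written $(t,x)$. (P1) Find $(u,m)$ with $m\ge0$ such that $$\begin{cases}-u_t+H(x,u_x)=\int_0^x m(t,y)\,dy & \text{in }\Omega,\\ m_t-\big(m\,D_pH(x,u_x)\big)_x=0 & \text{in }\Omega,\\ m(0,x)=m_0(x),\quad m(T,x)=m_T(x), & x\in[0,1],\\ -m\,D_pH(x,u_x)=0 & \text{on }(0,T)\times\{0,1\}.\end{cases}$$ A classical solution is one with $(u,m)\in C^2(\overline\Omega)\times C^1(\overline\Omega)$. (P2) Find $\varphi$ with $\varphi_x\ge0$ such that $$\big(F_j(x,-\varphi_t,\varphi_x)\big)_t+\big(-F_m(x,-\varphi_t,\varphi_x)\big)_x-\varphi_x=0\ \text{ in }\Omega,\qquad \varphi=\varphi^0\ \text{ on }\partial\Omega .$$ A classical solution is one with $\varphi\in C^2(\overline\Omega)$. Here $F(x,j,m)=\sup_{p\in\mathbb{R}}(-jp-mH(x,p))$, which for $m>0$ equals $m\,L(x,j/m)$ with $L(x,v)=\sup_{p\in\mathbb{R}}(-vp-H(x,p))$; $F_j,F_m$ are the partial derivatives of $F$ in $j,m$ (at $m>0$); and $$\varphi^0(t,x)=\frac{T-t}{T}\int_0^x m_0(y)\,dy+\frac tT\int_0^x m_T(y)\,dy .$$ *)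

(* Defs.v *)
From Stdlib Require Import Reals Lra.
From Coquelicot Require Import Coquelicot.
Open Scope R_scope.

(* A function on a closed interval or rectangle is a total function of which
   only the values on that set are used.  Accordingly all derivatives are taken
   along the domain (one-sided at its endpoints), by replacing [locally x] with
   [within I (locally x)] in Coquelicot's [is_derive]; at an interior point of
   [I] this is the ordinary derivative. *)

Definition Icc (a b : R) (x : R) : Prop := a <= x <= b.
Definition Ioo (a b : R) (x : R) : Prop := a < x < b.
Definition Rall (x : R) : Prop := True.

Definition is_derive_in (I : R -> Prop) (f : R -> R) (x l : R) : Prop :=
  filterdiff f (within I (locally x)) (fun h : R => scal h l).

Definition ex_derive_in (I : R -> Prop) (f : R -> R) (x : R) : Prop :=
  exists l : R, is_derive_in I f x l.

Definition Derive_in (I : R -> Prop) (f : R -> R) (x : R) : R :=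
  iota (is_derive_in I f x).

Lemma is_derive_in_Rall (f : R -> R) (x l : R) :
  is_derive_in Rall f x l <-> is_derive f x l.
Proof.
split; intros [Hl Hd]; split; try exact Hl; intros z Hz eps.
- assert (Hz' : is_filter_lim (within Rall (locally x)) z).
  { intros P HP; generalize (Hz P HP); unfold within; apply filter_imp; intros y Hy _; exact Hy. }
  generalize (Hd z Hz' eps).
  unfold within; apply filter_imp; intros y Hy; exact (Hy I).
- assert (Hz' : is_filter_lim (locally x) z).
  { intros P HP; generalize (Hz P HP); unfold within; apply filter_imp; intros y Hy; exact (Hy I). }
  generalize (Hd z Hz' eps); unfold within; apply filter_imp; intros y Hy _; exact Hy.
Qed.

Lemma is_derive_in_interior (a b : R) (f : R -> R) (x l : R) :
  Ioo a b x -> is_derive_in (Icc a b) f x l <-> is_derive f x l.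
Proof.
intros Hx.
assert (Hloc : locally x (Icc a b)).
{ generalize (open_and _ _ (open_gt a) (open_lt b) x Hx).
  apply filter_imp; intros y [H1 H2]; split; apply Rlt_le; assumption. }
split; intros [Hl Hd]; split; try exact Hl; intros z Hz eps.
- assert (Hz' : is_filter_lim (within (Icc a b) (locally x)) z).
  { intros P HP; generalize (Hz P HP); unfold within; apply filter_imp; intros y Hy _; exact Hy. }
  generalize (Hd z Hz' eps).
  intros Hy; generalize (filter_and _ _ Hloc Hy).
  unfold within; apply filter_imp; intros y [H1 H2]; exact (H2 H1).
- assert (Hz' : is_filter_lim (locally x) z).
  { intros P HP; generalize (filter_and _ _ Hloc (Hz P HP)).
    unfold within; apply filter_imp; intros y [H1 H2]; exact (H2 H1). }
  generalize (Hd z Hz' eps); unfold within; apply filter_imp; intros y Hy _; exact Hy.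
Qed.

Lemma Derive_in_unique (a b : R) (f : R -> R) (x l : R) :
  a < b -> Icc a b x -> is_derive_in (Icc a b) f x l ->
  Derive_in (Icc a b) f x = l.
Proof.
intros Hab Hx Hl.
apply (iota_unique (V := R_CompleteNormedModule)); [| exact Hl].
intros k Hk.
assert (Hlim : is_filter_lim (within (Icc a b) (locally x)) x).
{ intros P HP; revert HP; unfold within; apply filter_imp; intros y Hy _; exact Hy. }
destruct (Req_dec k l) as [E | N]; [exact E | exfalso].
assert (He : 0 < Rabs (k - l) / 4).
{ apply Rdiv_lt_0_compat; [apply Rabs_pos_lt |]; lra. }
pose proof (proj2 Hl x Hlim (mkposreal _ He)) as Dl.
pose proof (proj2 Hk x Hlim (mkposreal _ He)) as Dk.
destruct (filter_and _ _ Dl Dk) as [d Hd].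
assert (Hy : exists y, Icc a b y /\ y <> x /\ Rabs (y - x) < d).
{ assert (Hd0 := cond_pos d); unfold Icc in *.
  destruct (Rlt_dec x b) as [Hb | Hb].
  - set (h := Rmin (d / 2) (b - x)).
    assert (h <= d / 2) by apply Rmin_l. assert (h <= b - x) by apply Rmin_r.
    assert (0 < h) by (apply Rmin_pos; lra).
    exists (x + h); repeat split; try lra.
    rewrite Rabs_pos_eq; lra.
  - set (h := Rmin (d / 2) (x - a)).
    assert (h <= d / 2) by apply Rmin_l. assert (h <= x - a) by apply Rmin_r.
    assert (0 < h) by (apply Rmin_pos; lra).
    exists (x - h); repeat split; try lra.
    rewrite Rabs_left; lra. }
destruct Hy as [y [Iy [Ny By]]].
destruct (Hd y By Iy) as [B1 B2].
change (Rabs (f y - f x - (y - x) * l) <= Rabs (k - l) / 4 * Rabs (y - x)) in B1.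
change (Rabs (f y - f x - (y - x) * k) <= Rabs (k - l) / 4 * Rabs (y - x)) in B2.
assert (Hp : 0 < Rabs (y - x)) by (apply Rabs_pos_lt; lra).
assert (Hq : 0 < Rabs (k - l)) by (apply Rabs_pos_lt; lra).
assert (E : Rabs (k - l) * Rabs (y - x) =
  Rabs ((f y - f x - (y - x) * l) - (f y - f x - (y - x) * k))).
{ rewrite <- Rabs_mult; f_equal; ring. }
pose proof (Rabs_triang (f y - f x - (y - x) * l)
  (- (f y - f x - (y - x) * k))) as Tr.
rewrite Rabs_Ropp in Tr.
change (Rabs (k - l) * Rabs (y - x) =
  Rabs ((f y - f x - (y - x) * l) + - (f y - f x - (y - x) * k))) in E.
nra.
Qed.

Definition C1_on (I : R -> Prop) (f : R -> R) : Prop :=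
  (forall x, I x -> ex_derive_in I f x) /\ continuous_on I (Derive_in I f).

Definition pd1 (I : R -> Prop) (f : R -> R -> R) (x y : R) : R :=
  Derive_in I (fun s => f s y) x.

Definition pd2 (J : R -> Prop) (f : R -> R -> R) (x y : R) : R :=
  Derive_in J (fun s => f x s) y.

Definition C0_on2 (I J : R -> Prop) (f : R -> R -> R) : Prop :=
  continuous_on (fun z : R * R => I (fst z) /\ J (snd z))
                (fun z : R * R => f (fst z) (snd z)).

Record C1_on2 (I J : R -> Prop) (f : R -> R -> R) : Prop := {
  C1_on2_cont : C0_on2 I J f;
  C1_on2_ex1 : forall x y, I x -> J y -> ex_derive_in I (fun s => f s y) x;
  C1_on2_ex2 : forall x y, I x -> J y -> ex_derive_in J (fun s => f x s) y;
  C1_on2_cont1 : C0_on2 I J (pd1 I f);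
  C1_on2_cont2 : C0_on2 I J (pd2 J f)
}.

Record C2_on2 (I J : R -> Prop) (f : R -> R -> R) : Prop := {
  C2_on2_C1 : C1_on2 I J f;
  C2_on2_pd1 : C1_on2 I J (pd1 I f);
  C2_on2_pd2 : C1_on2 I J (pd2 J f)
}.

(* Partial derivatives of functions of [(t, x)] on [[0,T] x [0,1]]. *)
Definition pdt (T : R) : (R -> R -> R) -> R -> R -> R := pd1 (Icc 0 T).
Definition pdx : (R -> R -> R) -> R -> R -> R := pd2 (Icc 0 1).

Definition DpH (H : R -> R -> R) (x p : R) : R := Derive (fun q => H x q) p.
Definition DppH (H : R -> R -> R) (x p : R) : R :=
  Derive (fun q => DpH H x q) p.

Definition F (H : R -> R -> R) (x j m : R) : Rbar :=
  Lub_Rbar (fun y => exists p : R, y = - j * p - m * H x p).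

(* [F] is finite for [m > 0] when [H x] is superlinear; only there are the
   real-valued derivatives below meaningful. *)
Definition Fj (H : R -> R -> R) (x j m : R) : R :=
  Derive (fun k => real (F H x k m)) j.
Definition Fm (H : R -> R -> R) (x j m : R) : R :=
  Derive (fun n => real (F H x j n)) m.

(* The two existence clauses in [P2_pde] and the one in [P1_continuity] keep
   the equations from being satisfied through junk values of [Derive_in]. *)

Record P1_classical (T : R) (H : R -> R -> R) (m0 mT : R -> R)
    (u m : R -> R -> R) : Prop := {
  P1_C2 : C2_on2 (Icc 0 T) (Icc 0 1) u;
  P1_C1 : C1_on2 (Icc 0 T) (Icc 0 1) m;
  P1_nonneg : forall t x, Icc 0 T t -> Icc 0 1 x -> 0 <= m t x;
  P1_HJ : forall t x, Ioo 0 T t -> Ioo 0 1 x ->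
    - pdt T u t x + H x (pdx u t x) = RInt (fun y => m t y) 0 x;
  P1_continuity : forall t x, Ioo 0 T t -> Ioo 0 1 x ->
    ex_derive_in (Icc 0 1) (fun y => m t y * DpH H y (pdx u t y)) x /\
    pdt T m t x - pdx (fun s y => m s y * DpH H y (pdx u s y)) t x = 0;
  P1_initial : forall x, Icc 0 1 x -> m 0 x = m0 x;
  P1_final : forall x, Icc 0 1 x -> m T x = mT x;
  P1_noflux : forall t x, Ioo 0 T t -> x = 0 \/ x = 1 ->
    - m t x * DpH H x (pdx u t x) = 0
}.

Definition phi0 (T : R) (m0 mT : R -> R) (t x : R) : R :=
  (T - t) / T * RInt m0 0 x + t / T * RInt mT 0 x.

Definition Fj_along (T : R) (H phi : R -> R -> R) (t x : R) : R :=
  Fj H x (- pdt T phi t x) (pdx phi t x).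
Definition Fm_along (T : R) (H phi : R -> R -> R) (t x : R) : R :=
  Fm H x (- pdt T phi t x) (pdx phi t x).

Record P2_classical (T : R) (H : R -> R -> R) (m0 mT : R -> R)
    (phi : R -> R -> R) : Prop := {
  P2_C2 : C2_on2 (Icc 0 T) (Icc 0 1) phi;
  P2_nonneg : forall t x, Icc 0 T t -> Icc 0 1 x -> 0 <= pdx phi t x;
  P2_pde : forall t x, Ioo 0 T t -> Ioo 0 1 x ->
    ex_derive_in (Icc 0 T) (fun s => Fj_along T H phi s x) t /\
    ex_derive_in (Icc 0 1) (fun y => - Fm_along T H phi t y) x /\
    pdt T (Fj_along T H phi) t x
      + pdx (fun s y => - Fm_along T H phi s y) t x - pdx phi t x = 0;
  P2_boundary : forall t x, Icc 0 T t -> Icc 0 1 x ->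
    t = 0 \/ t = T \/ x = 0 \/ x = 1 -> phi t x = phi0 T m0 mT t x
}.

Definition relations (T : R) (H phi u m : R -> R -> R) : Prop :=
  forall t x, Icc 0 T t -> Icc 0 1 x ->
    m t x = pdx phi t x /\
    u t x = - RInt (fun y => Fj_along T H phi t y) 0 x
            - RInt (fun s => Fm_along T H phi s 0) 0 t.

(* Main.v *)
(** Let [q] be the maximizer in [F(x, - phi_t, phi_x)], that is
    [DpH(x, q) = phi_t / phi_x].  By the envelope theorem [F_j = - q] and
    [F_m = - H(x, q)], and [q] is [C^1] by implicit differentiation, so (P2)
    reads [- q_t + (H(x, q))_x = phi_x] and the relations say [u_x = q] and [u_t(t, 0) = H(0, q(t, 0))].  Integrating the
    equation in [x] gives [u_t = H(x, q) - phi], which is the Hamilton-Jacobi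
    equation, and the continuity equation is the symmetry of the second
    derivatives of [phi].  Conversely [phi = int_0^x m] has [phi_x = m] and,
    by the continuity equation and the no-flux condition,
    [phi_t = m DpH(x, u_x)]; hence [q = u_x], and (P2) is the [x]-derivative of
    the Hamilton-Jacobi equation. *)

Require Import Defs.
From Stdlib Require Import Reals Lra.
From Coquelicot Require Import Coquelicot.
Open Scope R_scope.

(** * Calculus along an interval *)

(** The boundary shapes the proof. The equations are posed on the open rectangle, while the
    solutions are C^1 or C^2 up to the edges and both directions integrate from [x = 0] and [t = 0].
    Hence the mean value theorem, the chain rule, implicit differentiation and the symmetry of mixed
    derivatives are proved for derivatives along an [interval], and an equation is extended to the
    closed rectangle by continuity before it is integrated. One notion of interval serves for
    [[0,T]], [[0,1]], the line of momenta and the half-line of denominators. The other issue is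
    regularity. [F] is a mere supremum, so its differentiability has to be derived, and [H] is only
    C^1. That [u] is C^2 is read off its gradient: both components are C^1 once [q] is, and [q] is
    C^1 because [DpH] is C^1 with positive [p]-derivative. Likewise [phi] is C^2 because its
    gradient consists of the flux and the density, both C^1. *)

Definition interval (I : R -> Prop) : Prop :=
  (forall x y z, I x -> I y -> x <= z <= y -> I z) /\
  (exists x y, I x /\ I y /\ x < y).

Lemma interval_Icc (a b : R) : a < b -> interval (Icc a b).
Proof.
intros Hab; unfold Icc; split.
- intros x y z Hx Hy Hz; lra.
- exists a, b; lra.
Qed.

Lemma interval_Rall : interval Rall.
Proof.
split; unfold Rall; [trivial |]. exists 0, 1; repeat split; lra.
Qed.

Lemma interval_pos : interval (fun x => 0 < x).
Proof.
split; [intros x y z Hx Hy Hz; lra |]. exists 1, 2; lra.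
Qed.

Lemma interval_between (I : R -> Prop) (x y z : R) :
  interval I -> I x -> I y -> Rmin x y <= z <= Rmax x y -> I z.
Proof.
intros [HI _] Hx Hy; unfold Rmin, Rmax; destruct (Rle_dec x y); intros Hz.
- exact (HI x y z Hx Hy Hz).
- exact (HI y x z Hy Hx Hz).
Qed.

Lemma between_dist (x y z : R) : Rmin x y <= z <= Rmax x y -> Rabs (z - x) <= Rabs (y - x).
Proof.
unfold Rmin, Rmax; destruct (Rle_dec x y); intros Hz; unfold Rabs;
  destruct (Rcase_abs (z - x)), (Rcase_abs (y - x)); lra.
Qed.

Definition cont1 (I : R -> Prop) (f : R -> R) : Prop :=
  forall x, I x -> forall eps, 0 < eps -> exists d, 0 < d /\
    forall y, I y -> Rabs (y - x) < d -> Rabs (f y - f x) < eps.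

Definition cont2 (I J : R -> Prop) (f : R -> R -> R) : Prop :=
  forall x y, I x -> J y -> forall eps, 0 < eps -> exists d, 0 < d /\
    forall x' y', I x' -> J y' -> Rabs (x' - x) < d -> Rabs (y' - y) < d ->
      Rabs (f x' y' - f x y) < eps.

(** Nothing is divided, so [y = x] needs no exclusion and error terms add up by the triangle
    inequality alone. *)
Definition deriv_at (I : R -> Prop) (f : R -> R) (x l : R) : Prop :=
  forall eps, 0 < eps -> exists d, 0 < d /\
    forall y, I y -> Rabs (y - x) < d ->
      Rabs (f y - f x - l * (y - x)) <= eps * Rabs (y - x).

Lemma is_derive_in_eps (I : R -> Prop) (f : R -> R) (x l : R) :
  I x -> is_derive_in I f x l <-> deriv_at I f x l.
Proof.
intros Hx.
assert (Hlim : is_filter_lim (within I (locally x)) x).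
{ intros P HP; revert HP; unfold within; apply filter_imp; intros y Hy _; exact Hy. }
split.
- intros [_ Hd] eps He.
  destruct (Hd x Hlim (mkposreal _ He)) as [d Hd'].
  exists d; split; [apply cond_pos |]; intros y Iy Hy.
  specialize (Hd' y Hy Iy).
  change (Rabs (f y - f x - (y - x) * l) <= eps * Rabs (y - x)) in Hd'.
  rewrite (Rmult_comm l); exact Hd'.
- intros Hd; split; [exact (is_linear_scal_l (K := R_AbsRing) (V := R_NormedModule) l) |].
  intros z Hz eps.
  (* Since [x] lies in [I], it belongs to every set of the filter; a limit [z] other than [x] would
     have a ball that misses [x]. *)
  assert (Ez : x = z).
  { destruct (Req_dec x z) as [E | N]; [exact E | exfalso].
    assert (Hp : 0 < Rabs (x - z)) by (apply Rabs_pos_lt; lra).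
    assert (HP : locally z (fun y => Rabs (y - z) < Rabs (x - z))).
    { exists (mkposreal _ Hp); intros y Hy; exact Hy. }
    destruct (Hz _ HP) as [d Hd'].
    specialize (Hd' x (ball_center x d) Hx); lra. }
  subst z.
  destruct (Hd eps (cond_pos eps)) as [d [Hd0 Hd']].
  exists (mkposreal _ Hd0); intros y Hy Iy.
  specialize (Hd' y Iy Hy).
  change (Rabs (f y - f x - (y - x) * l) <= eps * Rabs (y - x)).
  rewrite (Rmult_comm _ l); exact Hd'.
Qed.

Lemma is_derive_deriv_at (I : R -> Prop) (f : R -> R) (x l : R) :
  is_derive f x l -> deriv_at I f x l.
Proof.
intros Hd eps He.
apply is_derive_in_Rall, is_derive_in_eps in Hd; [| exact Logic.I].
destruct (Hd eps He) as [d [Hd0 Hd']].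
exists d; split; [exact Hd0 |]; intros y _; apply Hd'; exact Logic.I.
Qed.

Lemma C0_on2_eps (I J : R -> Prop) (f : R -> R -> R) :
  C0_on2 I J f <-> cont2 I J f.
Proof.
split.
- intros Hf x y Hx Hy eps He.
  assert (HP : locally (f x y) (fun v => Rabs (v - f x y) < eps)).
  { exists (mkposreal _ He); intros v Hv; exact Hv. }
  destruct (Hf (x, y) (conj Hx Hy) _ HP) as [d Hd].
  exists d; split; [apply cond_pos |]; intros x' y' Hx' Hy' Dx Dy.
  exact (Hd (x', y') (conj Dx Dy) (conj Hx' Hy')).
- intros Hf [x y] [Hx Hy] P [eps HP]; simpl in *.
  destruct (Hf x y Hx Hy eps (cond_pos eps)) as [d [Hd0 Hd]].
  exists (mkposreal _ Hd0); intros [x' y'] [Dx Dy] [Hx' Hy']; apply HP.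
  exact (Hd x' y' Hx' Hy' Dx Dy).
Qed.

(** Going from [x] a fraction [s] of the way to another point of [I] stays in [I] by convexity, and
    [s] is chosen to stay within [d / 2]. This is what makes one-sided derivatives unique. *)
Lemma interval_near (I : R -> Prop) (x : R) :
  interval I -> I x -> forall d, 0 < d -> exists y, I y /\ y <> x /\ Rabs (y - x) < d.
Proof.
intros HI Hx d Hd.
assert (Hz : exists z, I z /\ z <> x).
{ destruct HI as [_ [a [b [Ha [Hb Hab]]]]].
  destruct (Req_dec a x); [exists b | exists a]; split; trivial; lra. }
destruct Hz as [z [Hz Nz]].
assert (Hp : 0 < Rabs (z - x)) by (apply Rabs_pos_lt; lra).
set (s := Rmin 1 (d / (2 * Rabs (z - x)))).
assert (Hs : 0 < s).
{ apply Rmin_pos; [lra |]; apply Rdiv_lt_0_compat; lra. }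
assert (Hs1 : s <= 1) by apply Rmin_l.
assert (Hs2 : s * Rabs (z - x) <= d / 2).
{ apply Rle_trans with (d / (2 * Rabs (z - x)) * Rabs (z - x)).
  - apply Rmult_le_compat_r; [lra | apply Rmin_r].
  - right; field; lra. }
exists (x + s * (z - x)); split; [| split].
- apply (interval_between I x z); trivial.
  unfold Rmin, Rmax; destruct (Rle_dec x z); nra.
- intros E; assert (s * (z - x) = 0) by lra.
  destruct (Rmult_integral _ _ H); lra.
- replace (x + s * (z - x) - x) with (s * (z - x)) by ring.
  rewrite Rabs_mult, (Rabs_pos_eq s); lra.
Qed.

Lemma deriv_at_unique (I : R -> Prop) (f : R -> R) (x k l : R) :
  interval I -> I x -> deriv_at I f x k -> deriv_at I f x l -> k = l.
Proof.
intros HI Hx Hk Hl.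
destruct (Req_dec k l) as [E | N]; [exact E | exfalso].
assert (Hq : 0 < Rabs (k - l)) by (apply Rabs_pos_lt; lra).
(* With quarters, the two errors add up to at most half of [Rabs (k - l) * Rabs (y - x)], which they
   should bound from above. *)
destruct (Hk (Rabs (k - l) / 4)) as [d1 [Hd1 D1]]; [lra |].
destruct (Hl (Rabs (k - l) / 4)) as [d2 [Hd2 D2]]; [lra |].
destruct (interval_near I x HI Hx (Rmin d1 d2)) as [y [Hy [Ny By]]].
{ apply Rmin_pos; trivial. }
specialize (D1 y Hy (Rlt_le_trans _ _ _ By (Rmin_l _ _))).
specialize (D2 y Hy (Rlt_le_trans _ _ _ By (Rmin_r _ _))).
assert (Hp : 0 < Rabs (y - x)) by (apply Rabs_pos_lt; lra).
pose proof (Rabs_triang (f y - f x - l * (y - x)) (- (f y - f x - k * (y - x)))) as Tr.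
rewrite Rabs_Ropp in Tr.
replace (f y - f x - l * (y - x) + - (f y - f x - k * (y - x)))
  with ((k - l) * (y - x)) in Tr by ring.
rewrite Rabs_mult in Tr; nra.
Qed.

Lemma deriv_at_Derive_in (I : R -> Prop) (f : R -> R) (x l : R) :
  interval I -> I x -> deriv_at I f x l -> Derive_in I f x = l.
Proof.
intros HI Hx Hl.
apply (iota_unique (V := R_CompleteNormedModule)).
- intros k Hk; apply is_derive_in_eps in Hk; [| exact Hx].
  exact (deriv_at_unique I f x k l HI Hx Hk Hl).
- apply is_derive_in_eps; trivial.
Qed.

Lemma Derive_in_deriv_at (I : R -> Prop) (f : R -> R) (x : R) :
  interval I -> I x -> ex_derive_in I f x -> deriv_at I f x (Derive_in I f x).
Proof.
intros HI Hx [l Hl]; apply is_derive_in_eps in Hl; [| exact Hx].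
rewrite (deriv_at_Derive_in I f x l); trivial.
Qed.

Lemma deriv_at_ext (I : R -> Prop) (f g : R -> R) (x l k : R) :
  I x -> (forall y, I y -> f y = g y) -> l = k -> deriv_at I f x l -> deriv_at I g x k.
Proof.
intros Hx E <- Hf eps He; destruct (Hf eps He) as [d [Hd D]].
exists d; split; [exact Hd |]; intros y Hy Dy.
rewrite <- (E y Hy), <- (E x Hx); exact (D y Hy Dy).
Qed.

Lemma deriv_at_lipschitz (I : R -> Prop) (f : R -> R) (x l : R) :
  deriv_at I f x l -> exists d, 0 < d /\
    forall y, I y -> Rabs (y - x) < d -> Rabs (f y - f x) <= (Rabs l + 1) * Rabs (y - x).
Proof.
intros Hf; destruct (Hf 1 Rlt_0_1) as [d [Hd D]].
exists d; split; [exact Hd |]; intros y Hy Dy.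
specialize (D y Hy Dy).
pose proof (Rabs_triang (f y - f x - l * (y - x)) (l * (y - x))) as Tr.
rewrite Rabs_mult in Tr.
replace (f y - f x - l * (y - x) + l * (y - x)) with (f y - f x) in Tr by ring.
lra.
Qed.

Lemma deriv_at_cont1 (I : R -> Prop) (f df : R -> R) :
  (forall x, I x -> deriv_at I f x (df x)) -> cont1 I f.
Proof.
intros Hf x Hx eps He.
destruct (deriv_at_lipschitz I f x _ (Hf x Hx)) as [d [Hd D]].
assert (Hp := Rabs_pos (df x)).
exists (Rmin d (eps / (Rabs (df x) + 1))); split.
- apply Rmin_pos; trivial; apply Rdiv_lt_0_compat; lra.
- intros y Hy Dy.
  apply Rle_lt_trans with ((Rabs (df x) + 1) * Rabs (y - x)).
  + apply D; trivial; exact (Rlt_le_trans _ _ _ Dy (Rmin_l _ _)).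
  + apply (Rmult_lt_reg_r (/ (Rabs (df x) + 1))); [apply Rinv_0_lt_compat; lra |].
    apply Rle_lt_trans with (Rabs (y - x)); [right; field; lra |].
    exact (Rlt_le_trans _ _ _ Dy (Rmin_r _ _)).
Qed.

(* Composing with [clamp a b] turns one-sided continuity on [[a, b]] into
   continuity on the line, which Coquelicot's theorems require. *)
Definition clamp (a b x : R) : R := Rmax a (Rmin b x).

Lemma clamp_in (a b x : R) : a <= b -> Icc a b (clamp a b x).
Proof.
unfold clamp, Icc, Rmax, Rmin; destruct (Rle_dec b x);
  [destruct (Rle_dec a b) | destruct (Rle_dec a x)]; lra.
Qed.

Lemma clamp_id (a b x : R) : Icc a b x -> clamp a b x = x.
Proof.
unfold clamp, Icc, Rmax, Rmin; destruct (Rle_dec b x);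
  [destruct (Rle_dec a b) | destruct (Rle_dec a x)]; lra.
Qed.

Lemma clamp_lipschitz (a b x y : R) : Rabs (clamp a b y - clamp a b x) <= Rabs (y - x).
Proof.
unfold clamp, Rmax, Rmin; destruct (Rle_dec b x), (Rle_dec b y);
  repeat match goal with |- context [Rle_dec ?u ?v] => destruct (Rle_dec u v) end;
  unfold Rabs; repeat match goal with |- context [Rcase_abs ?u] => destruct (Rcase_abs u) end; lra.
Qed.

Lemma cont1_clamp (a b : R) (f : R -> R) :
  a <= b -> cont1 (Icc a b) f -> forall x, continuous (fun y => f (clamp a b y)) x.
Proof.
intros Hab Hf x P [eps HP].
destruct (Hf (clamp a b x) (clamp_in a b x Hab) eps (cond_pos eps)) as [d [Hd D]].
exists (mkposreal _ Hd); intros y Hy; apply HP.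
apply D; [apply clamp_in; exact Hab |].
exact (Rle_lt_trans _ _ _ (clamp_lipschitz a b x y) Hy).
Qed.

Lemma cont1_subset (I J : R -> Prop) (f : R -> R) :
  (forall x, J x -> I x) -> cont1 I f -> cont1 J f.
Proof.
intros HJ Hf x Hx eps He; destruct (Hf x (HJ x Hx) eps He) as [d [Hd D]].
exists d; split; trivial; intros y Hy; apply D; auto.
Qed.

Lemma deriv_at_interior (I : R -> Prop) (f : R -> R) (x l : R) :
  locally x I -> deriv_at I f x l -> is_derive f x l.
Proof.
intros [r Hr] Hf.
apply is_derive_in_Rall, is_derive_in_eps; [exact Logic.I |].
intros eps He; destruct (Hf eps He) as [d [Hd D]].
exists (Rmin d r); split; [apply Rmin_pos; [exact Hd | apply cond_pos] |].
intros y _ Dy; apply D.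
- apply Hr; exact (Rlt_le_trans _ _ _ Dy (Rmin_r _ _)).
- exact (Rlt_le_trans _ _ _ Dy (Rmin_l _ _)).
Qed.

Lemma locally_open_interval (a b x : R) : a < x < b -> locally x (fun y => a < y < b).
Proof.
intros Hx; apply (open_and _ _ (open_gt a) (open_lt b)); exact Hx.
Qed.

(** Strictly between [x] and [y] the derivative along [I] is two-sided; at the two ends only
    continuity is required, and clamping supplies it without changing any value used. *)
Lemma MVT_in (I : R -> Prop) (f df : R -> R) (x y : R) :
  interval I -> (forall z, I z -> deriv_at I f z (df z)) -> I x -> I y ->
  exists c, I c /\ Rmin x y <= c <= Rmax x y /\ f y - f x = df c * (y - x).
Proof.
intros HI Hf Hx Hy.
set (a := Rmin x y); set (b := Rmax x y).
assert (Hab : a <= b) by (apply Rminmax).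
assert (Hsub : forall z, Icc a b z -> I z).
{ intros z Hz; exact (interval_between I x y z HI Hx Hy Hz). }
assert (Hc : cont1 (Icc a b) f).
{ apply (cont1_subset I); trivial; exact (deriv_at_cont1 I f df Hf). }
destruct (MVT_gen (fun z => f (clamp a b z)) x y df) as [c [Hc1 Hc2]].
- fold a b; intros z Hz.
  apply (is_derive_ext_loc f).
  + generalize (locally_open_interval a b z Hz); apply filter_imp.
    intros w Hw; rewrite clamp_id; [reflexivity | unfold Icc; lra].
  + apply (deriv_at_interior I).
    * generalize (locally_open_interval a b z Hz); apply filter_imp.
      intros w Hw; apply Hsub; unfold Icc; lra.
    * apply Hf, Hsub; unfold Icc; lra.
- fold a b; intros z Hz; apply continuity_pt_filterlim.
  exact (cont1_clamp a b f Hab Hc z).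
- fold a b in Hc1; exists c; repeat split; try (apply Hc1).
  + apply Hsub; exact Hc1.
  + rewrite <- Hc2, !clamp_id; trivial; unfold Icc, a, b.
    * split; [apply Rmin_l | apply Rmax_l].
    * split; [apply Rmin_r | apply Rmax_r].
Qed.

(** * Functions of two variables *)

Lemma cont2_ext (I J : R -> Prop) (f g : R -> R -> R) :
  (forall x y, I x -> J y -> f x y = g x y) -> cont2 I J f -> cont2 I J g.
Proof.
intros E Hf x y Hx Hy eps He; destruct (Hf x y Hx Hy eps He) as [d [Hd D]].
exists d; split; [exact Hd |]; intros x' y' Hx' Hy'.
rewrite <- (E x y), <- (E x' y'); trivial; apply D; trivial.
Qed.

Lemma cont2_slice1 (I J : R -> Prop) (f : R -> R -> R) (y : R) :
  cont2 I J f -> J y -> cont1 I (fun x => f x y).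
Proof.
intros Hf Hy x Hx eps He; destruct (Hf x y Hx Hy eps He) as [d [Hd D]].
exists d; split; [exact Hd |]; intros x' Hx' Dx; apply D; trivial.
rewrite Rminus_diag, Rabs_R0; exact Hd.
Qed.

Lemma cont2_slice2 (I J : R -> Prop) (f : R -> R -> R) (x : R) :
  cont2 I J f -> I x -> cont1 J (fun y => f x y).
Proof.
intros Hf Hx y Hy eps He; destruct (Hf x y Hx Hy eps He) as [d [Hd D]].
exists d; split; [exact Hd |]; intros y' Hy' Dy; apply D; trivial.
rewrite Rminus_diag, Rabs_R0; exact Hd.
Qed.

Lemma cont2_comp (I J A B : R -> Prop) (K f g : R -> R -> R) :
  cont2 A B K -> cont2 I J f -> cont2 I J g ->
  (forall x y, I x -> J y -> A (f x y) /\ B (g x y)) ->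
  cont2 I J (fun x y => K (f x y) (g x y)).
Proof.
intros HK Hf Hg HAB x y Hx Hy eps He.
destruct (HAB x y Hx Hy) as [HA HB].
destruct (HK _ _ HA HB eps He) as [d [Hd D]].
destruct (Hf x y Hx Hy d Hd) as [d1 [Hd1 D1]].
destruct (Hg x y Hx Hy d Hd) as [d2 [Hd2 D2]].
exists (Rmin d1 d2); split; [apply Rmin_pos; trivial |].
intros x' y' Hx' Hy' Dx Dy; destruct (HAB x' y' Hx' Hy') as [HA' HB'].
apply D; trivial.
- apply D1; trivial; [apply (Rlt_le_trans _ _ _ Dx) | apply (Rlt_le_trans _ _ _ Dy)]; apply Rmin_l.
- apply D2; trivial; [apply (Rlt_le_trans _ _ _ Dx) | apply (Rlt_le_trans _ _ _ Dy)]; apply Rmin_r.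
Qed.

Lemma cont2_const (I J : R -> Prop) (c : R) : cont2 I J (fun _ _ => c).
Proof.
intros x y _ _ eps He; exists 1; split; [lra |]; intros.
rewrite Rminus_diag, Rabs_R0; exact He.
Qed.

Lemma cont2_fst (I J : R -> Prop) : cont2 I J (fun x _ => x).
Proof.
intros x y _ _ eps He; exists eps; split; trivial.
Qed.

Lemma cont2_snd (I J : R -> Prop) : cont2 I J (fun _ y => y).
Proof.
intros x y _ _ eps He; exists eps; split; trivial.
Qed.

Lemma cont2_of_continuous (I J : R -> Prop) (f : R -> R -> R) :
  (forall x y, I x -> J y -> continuous (fun z : R * R => f (fst z) (snd z)) (x, y)) ->
  cont2 I J f.
Proof.
intros Hf; apply C0_on2_eps; apply continuous_on_forall.
intros [x y] [Hx Hy]; apply Hf; trivial.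
Qed.

Lemma cont2_plus (I J : R -> Prop) (f g : R -> R -> R) :
  cont2 I J f -> cont2 I J g -> cont2 I J (fun x y => f x y + g x y).
Proof.
intros Hf Hg.
refine (cont2_comp I J Rall Rall (fun a b => a + b) f g _ Hf Hg _).
- apply cont2_of_continuous; intros a b _ _.
  apply (continuous_plus (V := R_NormedModule)); [apply continuous_fst | apply continuous_snd].
- split; exact Logic.I.
Qed.

Lemma cont2_mult (I J : R -> Prop) (f g : R -> R -> R) :
  cont2 I J f -> cont2 I J g -> cont2 I J (fun x y => f x y * g x y).
Proof.
intros Hf Hg.
refine (cont2_comp I J Rall Rall (fun a b => a * b) f g _ Hf Hg _).
- apply cont2_of_continuous; intros a b _ _.
  apply (continuous_mult (K := R_AbsRing)); [apply continuous_fst | apply continuous_snd].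
- split; exact Logic.I.
Qed.

Lemma cont2_opp (I J : R -> Prop) (f : R -> R -> R) :
  cont2 I J f -> cont2 I J (fun x y => - f x y).
Proof.
intros Hf; apply (cont2_ext _ _ (fun x y => (-1) * f x y)).
- intros; ring.
- apply cont2_mult; trivial; apply cont2_const.
Qed.

Lemma cont2_minus (I J : R -> Prop) (f g : R -> R -> R) :
  cont2 I J f -> cont2 I J g -> cont2 I J (fun x y => f x y - g x y).
Proof.
intros Hf Hg; apply cont2_plus; trivial; apply cont2_opp; trivial.
Qed.

Lemma cont2_div (I J : R -> Prop) (f g : R -> R -> R) :
  cont2 I J f -> cont2 I J g -> (forall x y, I x -> J y -> 0 < g x y) ->
  cont2 I J (fun x y => f x y / g x y).
Proof.
intros Hf Hg Hpos.
refine (cont2_comp I J Rall (fun b => 0 < b) (fun a b => a / b) f g _ Hf Hg _).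
- apply cont2_of_continuous; intros a b _ Hb.
  apply (continuous_mult (K := R_AbsRing)); [apply continuous_fst |].
  apply (continuous_comp (fun z : R * R => snd z) Rinv); [apply continuous_snd |].
  apply continuous_Rinv; simpl; lra.
- intros x y Hx Hy; split; [exact Logic.I | auto].
Qed.

(** The partial derivatives are explicit functions, so formulas can be computed and rewritten
    without passing through [Derive_in]. Joint continuity of [f] is a consequence, derived in
    [C1_pair_cont]. *)
Record C1_pair (I J : R -> Prop) (f f1 f2 : R -> R -> R) : Prop := {
  C1_pair_d1 : forall x y, I x -> J y -> deriv_at I (fun s => f s y) x (f1 x y);
  C1_pair_d2 : forall x y, I x -> J y -> deriv_at J (fun s => f x s) y (f2 x y);
  C1_pair_cont1 : cont2 I J f1;
  C1_pair_cont2 : cont2 I J f2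
}.

Lemma C1_pair_ext (I J : R -> Prop) (f f1 f2 g g1 g2 : R -> R -> R) :
  (forall x y, I x -> J y -> f x y = g x y) ->
  (forall x y, I x -> J y -> f1 x y = g1 x y) ->
  (forall x y, I x -> J y -> f2 x y = g2 x y) ->
  C1_pair I J f f1 f2 -> C1_pair I J g g1 g2.
Proof.
intros E E1 E2 [D1 D2 K1 K2]; split.
- intros x y Hx Hy; apply (deriv_at_ext I (fun s => f s y) _ x (f1 x y)); auto.
- intros x y Hx Hy; apply (deriv_at_ext J (fun s => f x s) _ y (f2 x y)); auto.
- exact (cont2_ext I J f1 g1 E1 K1).
- exact (cont2_ext I J f2 g2 E2 K2).
Qed.

Definition differentiable2_at (I J : R -> Prop) (f : R -> R -> R) (x y a b : R) : Prop :=
  forall eps, 0 < eps -> exists d, 0 < d /\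
    forall x' y', I x' -> J y' -> Rabs (x' - x) < d -> Rabs (y' - y) < d ->
      Rabs (f x' y' - f x y - a * (x' - x) - b * (y' - y))
        <= eps * (Rabs (x' - x) + Rabs (y' - y)).

(** The increment is split along the path through the corner [(x, y')], which stays in the rectangle
    even when [(x, y)] is on its boundary; each leg is a one-variable mean value. *)
Lemma C1_pair_differentiable2 (I J : R -> Prop) (f f1 f2 : R -> R -> R) (x y : R) :
  interval I -> interval J -> C1_pair I J f f1 f2 -> I x -> J y ->
  differentiable2_at I J f x y (f1 x y) (f2 x y).
Proof.
intros HI HJ [D1 D2 K1 K2] Hx Hy eps He.
destruct (K1 x y Hx Hy eps He) as [d1 [Hd1 C1]].
destruct (K2 x y Hx Hy eps He) as [d2 [Hd2 C2]].
exists (Rmin d1 d2); split; [apply Rmin_pos; trivial |].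
intros x' y' Hx' Hy' Dx Dy.
assert (Dx1 := Rlt_le_trans _ _ _ Dx (Rmin_l d1 d2)).
assert (Dx2 := Rlt_le_trans _ _ _ Dx (Rmin_r d1 d2)).
assert (Dy1 := Rlt_le_trans _ _ _ Dy (Rmin_l d1 d2)).
assert (Dy2 := Rlt_le_trans _ _ _ Dy (Rmin_r d1 d2)).
destruct (MVT_in I (fun s => f s y') (fun s => f1 s y') x x' HI) as [c [Hc [Bc Ec]]]; auto.
destruct (MVT_in J (fun s => f x s) (fun s => f2 x s) y y' HJ) as [e [Hc' [Be Ee]]]; auto.
assert (A1 : Rabs (f1 c y' - f1 x y) < eps).
{ apply C1; trivial; exact (Rle_lt_trans _ _ _ (between_dist _ _ _ Bc) Dx1). }
assert (A2 : Rabs (f2 x e - f2 x y) < eps).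
{ apply C2; trivial.
  - rewrite Rminus_diag, Rabs_R0; trivial.
  - exact (Rle_lt_trans _ _ _ (between_dist _ _ _ Be) Dy2). }
replace (f x' y' - f x y - f1 x y * (x' - x) - f2 x y * (y' - y))
  with ((f1 c y' - f1 x y) * (x' - x) + (f2 x e - f2 x y) * (y' - y)).
2: { replace (f x' y' - f x y) with ((f x' y' - f x y') + (f x y' - f x y)) by ring.
     rewrite Ec, Ee; ring. }
eapply Rle_trans; [apply Rabs_triang |]; rewrite !Rabs_mult, Rmult_plus_distr_l.
apply Rplus_le_compat; apply Rmult_le_compat_r; try apply Rabs_pos; lra.
Qed.

Lemma C1_pair_cont (I J : R -> Prop) (f f1 f2 : R -> R -> R) :
  interval I -> interval J -> C1_pair I J f f1 f2 -> cont2 I J f.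
Proof.
intros HI HJ Hf x y Hx Hy eps He.
destruct (C1_pair_differentiable2 I J f f1 f2 x y HI HJ Hf Hx Hy 1 Rlt_0_1) as [d [Hd D]].
set (M := Rabs (f1 x y) + Rabs (f2 x y) + 1).
assert (P1 := Rabs_pos (f1 x y)); assert (P2 := Rabs_pos (f2 x y)).
assert (HM : 0 < M) by (unfold M; lra).
exists (Rmin d (eps / (2 * M))); split.
{ apply Rmin_pos; trivial; apply Rdiv_lt_0_compat; lra. }
intros x' y' Hx' Hy' Dx Dy.
assert (Dx1 := Rlt_le_trans _ _ _ Dx (Rmin_l _ _)).
assert (Dx2 := Rlt_le_trans _ _ _ Dx (Rmin_r _ _)).
assert (Dy1 := Rlt_le_trans _ _ _ Dy (Rmin_l _ _)).
assert (Dy2 := Rlt_le_trans _ _ _ Dy (Rmin_r _ _)).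
specialize (D x' y' Hx' Hy' Dx1 Dy1).
set (X := Rabs (x' - x)) in *; set (Y := Rabs (y' - y)) in *.
assert (HX : 0 <= X) by apply Rabs_pos; assert (HY : 0 <= Y) by apply Rabs_pos.
assert (T1 : Rabs (f x' y' - f x y) <= (X + Y) + Rabs (f1 x y) * X + Rabs (f2 x y) * Y).
{ replace (f x' y' - f x y) with ((f x' y' - f x y - f1 x y * (x' - x) - f2 x y * (y' - y))
    + f1 x y * (x' - x) + f2 x y * (y' - y)) by ring.
  eapply Rle_trans; [apply Rabs_triang |]; eapply Rle_trans;
    [apply Rplus_le_compat_r, Rabs_triang |].
  rewrite !Rabs_mult; fold X Y; lra. }
assert (E : eps / (2 * M) * M = eps / 2) by (field; lra).
assert (B : M * X < eps / 2) by nra.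
assert (B' : M * Y < eps / 2) by nra.
unfold M in B, B'; nra.
Qed.

Lemma C1_pair_C1_on2 (I J : R -> Prop) (f f1 f2 : R -> R -> R) :
  interval I -> interval J -> C1_pair I J f f1 f2 -> C1_on2 I J f.
Proof.
intros HI HJ Hf; destruct (Hf) as [D1 D2 K1 K2]; split.
- apply C0_on2_eps; exact (C1_pair_cont I J f f1 f2 HI HJ Hf).
- intros x y Hx Hy; exists (f1 x y); apply is_derive_in_eps; auto.
- intros x y Hx Hy; exists (f2 x y); apply is_derive_in_eps; auto.
- apply C0_on2_eps; apply (cont2_ext I J f1); trivial.
  intros x y Hx Hy; symmetry; apply deriv_at_Derive_in; auto.
- apply C0_on2_eps; apply (cont2_ext I J f2); trivial.
  intros x y Hx Hy; symmetry; apply deriv_at_Derive_in; auto.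
Qed.

Lemma C1_on2_pair (I J : R -> Prop) (f : R -> R -> R) :
  interval I -> interval J -> C1_on2 I J f -> C1_pair I J f (pd1 I f) (pd2 J f).
Proof.
intros HI HJ [K0 D1 D2 K1 K2]; split.
- intros x y Hx Hy; apply Derive_in_deriv_at; auto.
- intros x y Hx Hy; apply (Derive_in_deriv_at J (fun s => f x s)); auto.
- apply C0_on2_eps; trivial.
- apply C0_on2_eps; trivial.
Qed.

Lemma C1_pair_pd1 (I J : R -> Prop) (f f1 f2 : R -> R -> R) (x y : R) :
  interval I -> C1_pair I J f f1 f2 -> I x -> J y -> pd1 I f x y = f1 x y.
Proof.
intros HI Hf Hx Hy; apply deriv_at_Derive_in; trivial; apply (C1_pair_d1 _ _ _ _ _ Hf); trivial.
Qed.

Lemma C1_pair_pd2 (I J : R -> Prop) (f f1 f2 : R -> R -> R) (x y : R) :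
  interval J -> C1_pair I J f f1 f2 -> I x -> J y -> pd2 J f x y = f2 x y.
Proof.
intros HJ Hf Hx Hy; apply deriv_at_Derive_in; trivial; apply (C1_pair_d2 _ _ _ _ _ Hf); trivial.
Qed.

Lemma C1_on2_ext (I J : R -> Prop) (f g : R -> R -> R) :
  interval I -> interval J -> (forall x y, I x -> J y -> f x y = g x y) ->
  C1_on2 I J f -> C1_on2 I J g.
Proof.
intros HI HJ E Hf; apply (C1_pair_C1_on2 I J g (pd1 I f) (pd2 J f)); trivial.
apply (C1_pair_ext I J f (pd1 I f) (pd2 J f)); trivial.
apply C1_on2_pair; trivial.
Qed.

Lemma C1_pair_C2_on2 (I J : R -> Prop) (f f1 f2 : R -> R -> R) :
  interval I -> interval J -> C1_pair I J f f1 f2 -> C1_on2 I J f1 -> C1_on2 I J f2 ->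
  C2_on2 I J f.
Proof.
intros HI HJ Hf H1 H2; split.
- exact (C1_pair_C1_on2 I J f f1 f2 HI HJ Hf).
- apply (C1_on2_ext I J f1); trivial.
  intros x y Hx Hy; symmetry; exact (C1_pair_pd1 I J f f1 f2 x y HI Hf Hx Hy).
- apply (C1_on2_ext I J f2); trivial.
  intros x y Hx Hy; symmetry; exact (C1_pair_pd2 I J f f1 f2 x y HJ Hf Hx Hy).
Qed.

Lemma deriv_at_comp2 (I A B : R -> Prop) (K : R -> R -> R) (f g : R -> R) (x a b k l : R) :
  I x -> (forall y, I y -> A (f y) /\ B (g y)) ->
  differentiable2_at A B K (f x) (g x) a b ->
  deriv_at I f x k -> deriv_at I g x l ->
  deriv_at I (fun y => K (f y) (g y)) x (a * k + b * l).
Proof.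
intros Hx HAB HK Hf Hg eps He.
destruct (deriv_at_lipschitz I f x k Hf) as [d1 [Hd1 L1]].
destruct (deriv_at_lipschitz I g x l Hg) as [d2 [Hd2 L2]].
assert (Pk := Rabs_pos k); assert (Pl := Rabs_pos l).
assert (Pa := Rabs_pos a); assert (Pb := Rabs_pos b).
(* [C] bounds the joint growth rate of [f] and [g] near [x], and [A'] dominates [Rabs a + Rabs b]:
   half of [eps] pays for linearizing [K], the other half for linearizing [f] and [g]. *)
set (C := Rabs k + 1 + (Rabs l + 1)).
assert (HC : 0 < C) by (unfold C; lra).
set (A' := Rabs a + Rabs b + 1).
assert (HA' : 0 < A') by (unfold A'; lra).
destruct (HK (eps / (2 * C))) as [d [Hd D]]; [apply Rdiv_lt_0_compat; lra |].
destruct (Hf (eps / (2 * A'))) as [d3 [Hd3 D3]]; [apply Rdiv_lt_0_compat; lra |].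
destruct (Hg (eps / (2 * A'))) as [d4 [Hd4 D4]]; [apply Rdiv_lt_0_compat; lra |].
set (r := Rmin (Rmin (Rmin d1 d2) (Rmin d3 d4)) (d / C)).
assert (Hr : 0 < r).
{ repeat apply Rmin_pos; trivial; apply Rdiv_lt_0_compat; lra. }
assert (R0 : r <= d / C) by apply Rmin_r.
assert (Rs : r <= Rmin (Rmin d1 d2) (Rmin d3 d4)) by apply Rmin_l.
assert (R12 := Rle_trans _ _ _ Rs (Rmin_l _ _)).
assert (R34 := Rle_trans _ _ _ Rs (Rmin_r _ _)).
assert (R1 := Rle_trans _ _ _ R12 (Rmin_l _ _)).
assert (R2 := Rle_trans _ _ _ R12 (Rmin_r _ _)).
assert (R3 := Rle_trans _ _ _ R34 (Rmin_l _ _)).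
assert (R4 := Rle_trans _ _ _ R34 (Rmin_r _ _)).
exists r; split; trivial; intros y Hy Dy.
specialize (L1 y Hy (Rlt_le_trans _ _ _ Dy R1)).
specialize (L2 y Hy (Rlt_le_trans _ _ _ Dy R2)).
specialize (D3 y Hy (Rlt_le_trans _ _ _ Dy R3)).
specialize (D4 y Hy (Rlt_le_trans _ _ _ Dy R4)).
set (h := Rabs (y - x)) in *.
assert (Hh : 0 <= h) by apply Rabs_pos.
assert (HCd : C * h < d).
{ replace d with (C * (d / C)) by (field; lra).
  apply Rmult_lt_compat_l; lra. }
destruct (HAB y Hy) as [HA HB].
assert (DK : Rabs (K (f y) (g y) - K (f x) (g x) - a * (f y - f x) - b * (g y - g x))
  <= eps / (2 * C) * (Rabs (f y - f x) + Rabs (g y - g x))).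
{ apply D; trivial; unfold C in HCd; nra. }
assert (DK' : Rabs (K (f y) (g y) - K (f x) (g x) - a * (f y - f x) - b * (g y - g x))
  <= eps / 2 * h).
{ eapply Rle_trans; [exact DK |].
  apply Rle_trans with (eps / (2 * C) * (C * h)).
  - apply Rmult_le_compat_l; [left; apply Rdiv_lt_0_compat; lra | unfold C; lra].
  - right; field; lra. }
replace (K (f y) (g y) - K (f x) (g x) - (a * k + b * l) * (y - x)) with
  ((K (f y) (g y) - K (f x) (g x) - a * (f y - f x) - b * (g y - g x))
   + (a * (f y - f x - k * (y - x)) + b * (g y - g x - l * (y - x)))) by ring.
eapply Rle_trans; [apply Rabs_triang |].
assert (T2 : Rabs (a * (f y - f x - k * (y - x)) + b * (g y - g x - l * (y - x)))
  <= A' * (eps / (2 * A') * h)).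
{ eapply Rle_trans; [apply Rabs_triang |]; rewrite !Rabs_mult.
  set (w := eps / (2 * A') * h) in *.
  assert (0 <= w) by (apply Rle_trans with (2 := D3); apply Rabs_pos).
  unfold A'; nra. }
replace (A' * (eps / (2 * A') * h)) with (eps / 2 * h) in T2 by (field; lra).
lra.
Qed.

Lemma C1_pair_comp (I J A B : R -> Prop) (K K1 K2 f f1 f2 g g1 g2 : R -> R -> R) :
  interval I -> interval J -> interval A -> interval B ->
  C1_pair A B K K1 K2 -> C1_pair I J f f1 f2 -> C1_pair I J g g1 g2 ->
  (forall x y, I x -> J y -> A (f x y) /\ B (g x y)) ->
  C1_pair I J (fun x y => K (f x y) (g x y))
    (fun x y => K1 (f x y) (g x y) * f1 x y + K2 (f x y) (g x y) * g1 x y)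
    (fun x y => K1 (f x y) (g x y) * f2 x y + K2 (f x y) (g x y) * g2 x y).
Proof.
intros HI HJ HA HB HK Hf Hg HAB.
assert (Cf := C1_pair_cont I J f f1 f2 HI HJ Hf).
assert (Cg := C1_pair_cont I J g g1 g2 HI HJ Hg).
assert (DK : forall x y, I x -> J y -> differentiable2_at A B K (f x y) (g x y)
  (K1 (f x y) (g x y)) (K2 (f x y) (g x y))).
{ intros x y Hx Hy; destruct (HAB x y Hx Hy).
  apply C1_pair_differentiable2; trivial. }
destruct HK as [_ _ CK1 CK2], Hf as [Df1 Df2 Cf1 Cf2], Hg as [Dg1 Dg2 Cg1 Cg2].
split.
- intros x y Hx Hy.
  apply (deriv_at_comp2 I A B K (fun s => f s y) (fun s => g s y)); auto.
- intros x y Hx Hy.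
  apply (deriv_at_comp2 J A B K (fun s => f x s) (fun s => g x s)); auto.
- apply cont2_plus; apply cont2_mult; trivial.
  + apply (cont2_comp I J A B K1 f g); trivial.
  + apply (cont2_comp I J A B K2 f g); trivial.
- apply cont2_plus; apply cont2_mult; trivial.
  + apply (cont2_comp I J A B K1 f g); trivial.
  + apply (cont2_comp I J A B K2 f g); trivial.
Qed.

Lemma C1_pair_snd (I J : R -> Prop) :
  C1_pair I J (fun _ y => y) (fun _ _ => 0) (fun _ _ => 1).
Proof.
split; try apply cont2_const; intros x y _ _; apply is_derive_deriv_at; auto_derive; trivial.
Qed.

Lemma C1_pair_mult (I J : R -> Prop) (f f1 f2 g g1 g2 : R -> R -> R) :
  interval I -> interval J -> C1_pair I J f f1 f2 -> C1_pair I J g g1 g2 ->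
  C1_pair I J (fun x y => f x y * g x y)
    (fun x y => g x y * f1 x y + f x y * g1 x y)
    (fun x y => g x y * f2 x y + f x y * g2 x y).
Proof.
intros HI HJ Hf Hg.
refine (C1_pair_comp I J Rall Rall (fun a b => a * b) (fun a b => b) (fun a b => a)
  f f1 f2 g g1 g2 HI HJ interval_Rall interval_Rall _ Hf Hg _).
- split; [intros a b _ _ | intros a b _ _ | apply cont2_snd | apply cont2_fst];
    apply is_derive_deriv_at; auto_derive; trivial; ring.
- split; exact Logic.I.
Qed.

Lemma C1_pair_div (I J : R -> Prop) (f f1 f2 g g1 g2 : R -> R -> R) :
  interval I -> interval J -> C1_pair I J f f1 f2 -> C1_pair I J g g1 g2 ->
  (forall x y, I x -> J y -> 0 < g x y) ->
  C1_pair I J (fun x y => f x y / g x y)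
    (fun x y => 1 / g x y * f1 x y + - f x y / (g x y * g x y) * g1 x y)
    (fun x y => 1 / g x y * f2 x y + - f x y / (g x y * g x y) * g2 x y).
Proof.
intros HI HJ Hf Hg Hpos.
refine (C1_pair_comp I J Rall (fun b => 0 < b) (fun a b => a / b)
  (fun a b => 1 / b) (fun a b => - a / (b * b))
  f f1 f2 g g1 g2 HI HJ interval_Rall interval_pos _ Hf Hg _).
- split.
  + intros a b _ Hb; apply is_derive_deriv_at; auto_derive; trivial; field; lra.
  + intros a b _ Hb; apply is_derive_deriv_at; auto_derive; [lra | field; lra].
  + apply cont2_div; [apply cont2_const | apply cont2_snd | trivial].
  + apply cont2_div; [apply cont2_opp, cont2_fst | apply cont2_mult; apply cont2_snd |].
    intros a b _ Hb; apply Rmult_lt_0_compat; trivial.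
- intros x y Hx Hy; split; [exact Logic.I | auto].
Qed.

Lemma C1_pair_along (I J : R -> Prop) (G G1 G2 r r1 r2 : R -> R -> R) :
  interval I -> interval J -> C1_pair J Rall G G1 G2 -> C1_pair I J r r1 r2 ->
  C1_pair I J (fun t x => G x (r t x))
    (fun t x => G2 x (r t x) * r1 t x)
    (fun t x => G1 x (r t x) + G2 x (r t x) * r2 t x).
Proof.
intros HI HJ HG Hr.
eapply C1_pair_ext; cycle 3.
- apply (C1_pair_comp I J J Rall G G1 G2 (fun _ x => x) (fun _ _ => 0) (fun _ _ => 1)
    r r1 r2); trivial.
  + apply interval_Rall.
  + apply C1_pair_snd.
  + intros x y Hx Hy; split; [exact Hy | exact Logic.I].
- reflexivity.
- intros; simpl; ring.
- intros; simpl; ring.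
Qed.

(** * Implicit differentiation *)

Lemma deriv_at_implicit (I : R -> Prop) (g : R -> R -> R) (r w : R -> R) (x a b c : R) :
  I x -> 0 < b -> cont1 I r ->
  differentiable2_at I Rall g x (r x) a b ->
  (forall y, I y -> g y (r y) = w y) -> deriv_at I w x c ->
  deriv_at I r x ((c - a) / b).
Proof.
intros Hx Hb Hr Hg E Hw eps He.
set (L := (c - a) / b).
assert (PL := Rabs_pos L).
set (M := 2 + Rabs L).
(* Linearizing [g y (r y) = w y] bounds [b] times the error [e] by [eta * (M * h) + eta * Rabs e],
   where [M] collects two copies of [h] and the slope [L]. The bound [b / 2] absorbs the last term
   on the left; the other bound leaves [eps * h]. *)
set (eta := Rmin (b / 2) (eps * b / (2 * M))).
assert (HM : 2 <= M) by (unfold M; lra).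
assert (Heta : 0 < eta).
{ apply Rmin_pos; [lra |]; apply Rdiv_lt_0_compat; nra. }
assert (E1 : eta <= b / 2) by apply Rmin_l.
assert (E2 : eta * M <= eps * (b / 2)).
{ apply Rle_trans with (eps * b / (2 * M) * M).
  - apply Rmult_le_compat_r; [lra | apply Rmin_r].
  - right; field; lra. }
destruct (Hg eta Heta) as [d1 [Hd1 D1]].
destruct (Hw eta Heta) as [d2 [Hd2 D2]].
destruct (Hr x Hx d1 Hd1) as [d3 [Hd3 D3]].
exists (Rmin d1 (Rmin d2 d3)); split; [repeat apply Rmin_pos; trivial |].
intros y Hy Dy.
assert (Dy1 := Rlt_le_trans _ _ _ Dy (Rmin_l _ _)).
assert (Dy' := Rlt_le_trans _ _ _ Dy (Rmin_r _ _)).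
assert (Dy2 := Rlt_le_trans _ _ _ Dy' (Rmin_l _ _)).
assert (Dy3 := Rlt_le_trans _ _ _ Dy' (Rmin_r _ _)).
specialize (D3 y Hy Dy3); specialize (D2 y Hy Dy2).
specialize (D1 y (r y) Hy Logic.I Dy1 D3).
rewrite (E y Hy), (E x Hx) in D1.
set (h := Rabs (y - x)) in *.
set (e := r y - r x - L * (y - x)).
assert (Hh : 0 <= h) by apply Rabs_pos.
assert (B : b * Rabs e <= eta * (h + Rabs (r y - r x)) + eta * h).
{ rewrite <- (Rabs_pos_eq b) at 1 by lra; rewrite <- Rabs_mult.
  replace (b * e) with (- (w y - w x - a * (y - x) - b * (r y - r x))
    + (w y - w x - c * (y - x))) by (unfold e, L; field; lra).
  eapply Rle_trans; [apply Rabs_triang |]; rewrite Rabs_Ropp; lra. }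
assert (B' : Rabs (r y - r x) <= Rabs e + Rabs L * h).
{ replace (r y - r x) with (e + L * (y - x)) by (unfold e; ring).
  eapply Rle_trans; [apply Rabs_triang |]; rewrite Rabs_mult; fold h; lra. }
assert (Pe := Rabs_pos e).
assert (B2 : b * Rabs e <= eta * (M * h) + eta * Rabs e).
{ unfold M; nra. }
assert (B3 : b / 2 * Rabs e <= eps * (b / 2) * h) by nra.
nra.
Qed.

(** The values of [G] at [p - eps] and [p + eps] lie on the two sides of [v t x]. This persists at
    nearby points because each perturbation is less than half the gap, and monotonicity in the
    second argument then traps [q]. *)
Lemma cont2_implicit (I J : R -> Prop) (G q v : R -> R -> R) :
  cont2 J Rall G ->
  (forall x p p', J x -> p < p' -> G x p < G x p') ->
  cont2 I J v -> (forall t x, I t -> J x -> G x (q t x) = v t x) ->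
  cont2 I J q.
Proof.
intros HG Hinc Hv E t x Ht Hx eps He.
set (p := q t x).
assert (I1 : G x (p - eps) < v t x).
{ rewrite <- E by trivial; apply Hinc; trivial; unfold p; lra. }
assert (I2 : v t x < G x (p + eps)).
{ rewrite <- E by trivial; apply Hinc; trivial; unfold p; lra. }
set (g1 := (v t x - G x (p - eps)) / 2); set (g2 := (G x (p + eps) - v t x) / 2).
set (gap := Rmin g1 g2).
assert (Hgap : 0 < gap) by (apply Rmin_pos; unfold g1, g2; lra).
assert (G1 : gap <= g1) by apply Rmin_l; assert (G2 : gap <= g2) by apply Rmin_r.
destruct (Hv t x Ht Hx gap Hgap) as [d1 [Hd1 D1]].
destruct (HG x (p - eps) Hx Logic.I gap Hgap) as [d2 [Hd2 D2]].
destruct (HG x (p + eps) Hx Logic.I gap Hgap) as [d3 [Hd3 D3]].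
exists (Rmin d1 (Rmin d2 d3)); split; [repeat apply Rmin_pos; trivial |].
intros t' x' Ht' Hx' Dt Dx.
assert (Dt1 := Rlt_le_trans _ _ _ Dt (Rmin_l _ _)).
assert (Dx1 := Rlt_le_trans _ _ _ Dx (Rmin_l _ _)).
assert (Dx' := Rlt_le_trans _ _ _ Dx (Rmin_r _ _)).
assert (Dx2 := Rlt_le_trans _ _ _ Dx' (Rmin_l _ _)).
assert (Dx3 := Rlt_le_trans _ _ _ Dx' (Rmin_r _ _)).
specialize (D1 t' x' Ht' Hx' Dt1 Dx1).
specialize (D2 x' (p - eps) Hx' Logic.I Dx2).
specialize (D3 x' (p + eps) Hx' Logic.I Dx3).
rewrite Rminus_diag, Rabs_R0 in D2, D3.
specialize (D2 Hd2); specialize (D3 Hd3).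
rewrite <- (E t' x') in D1 by trivial.
apply Rabs_def2 in D1; apply Rabs_def2 in D2; apply Rabs_def2 in D3.
unfold g1 in G1; unfold g2 in G2.
apply Rabs_def1; fold p.
- destruct (Rlt_dec (q t' x') (p + eps)) as [L | L]; [lra | exfalso].
  assert (G x' (p + eps) <= G x' (q t' x')).
  { destruct (Req_dec (p + eps) (q t' x')) as [-> | N]; [lra |].
    left; apply Hinc; trivial; lra. }
  lra.
- destruct (Rlt_dec (p - eps) (q t' x')) as [L | L]; [lra | exfalso].
  assert (G x' (q t' x') <= G x' (p - eps)).
  { destruct (Req_dec (q t' x') (p - eps)) as [-> | N]; [lra |].
    left; apply Hinc; trivial; lra. }
  lra.
Qed.

Lemma C1_pair_implicit (I J : R -> Prop) (G G1 G2 q v v1 v2 : R -> R -> R) :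
  interval I -> interval J -> C1_pair J Rall G G1 G2 ->
  (forall x p, J x -> 0 < G2 x p) ->
  (forall x p p', J x -> p < p' -> G x p < G x p') ->
  C1_pair I J v v1 v2 -> (forall t x, I t -> J x -> G x (q t x) = v t x) ->
  C1_pair I J q
    (fun t x => (v1 t x - 0) / G2 x (q t x))
    (fun t x => (v2 t x - G1 x (q t x)) / G2 x (q t x)).
Proof.
intros HI HJ HG Hpos Hinc Hv E.
assert (Cq : cont2 I J q).
{ apply (cont2_implicit I J G q v); trivial.
  - exact (C1_pair_cont J Rall G G1 G2 HJ interval_Rall HG).
  - exact (C1_pair_cont I J v v1 v2 HI HJ Hv). }
assert (DG : forall t x, I t -> J x ->
  differentiable2_at J Rall G x (q t x) (G1 x (q t x)) (G2 x (q t x))).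
{ intros t x Ht Hx; apply C1_pair_differentiable2; trivial; [apply interval_Rall | exact Logic.I]. }
assert (HJR : forall t x, I t -> J x -> J x /\ Rall (q t x)).
{ intros t x Ht Hx; split; [exact Hx | exact Logic.I]. }
destruct Hv as [Dv1 Dv2 Cv1 Cv2], HG as [DG1 DG2 CG1 CG2].
split.
- intros t x Ht Hx.
  (* At fixed [x] the function does not depend on [t], so its first partial derivative is 0; this is
     the origin of [v1 t x - 0]. *)
  apply (deriv_at_implicit I (fun _ p => G x p) (fun s => q s x) (fun s => v s x)); auto.
  + apply (cont2_slice1 I J); trivial.
  + intros eps He; destruct (DG2 x (q t x) Hx Logic.I eps He) as [d [Hd D]].
    exists d; split; trivial; intros s p _ _ _ Dp.
    replace (G x p - G x (q t x) - 0 * (s - t) - G2 x (q t x) * (p - q t x))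
      with (G x p - G x (q t x) - G2 x (q t x) * (p - q t x)) by ring.
    eapply Rle_trans; [apply D; trivial; exact Logic.I |].
    assert (P := Rabs_pos (s - t)); nra.
- intros t x Ht Hx.
  apply (deriv_at_implicit J G (fun s => q t s) (fun s => v t s)); auto.
  apply (cont2_slice2 I J); trivial.
- apply cont2_div; [apply cont2_minus; [trivial | apply cont2_const] | | auto].
  apply (cont2_comp I J J Rall G2 (fun _ x => x) q); trivial; apply cont2_snd.
- apply cont2_div; [apply cont2_minus; [trivial |] | | auto].
  + apply (cont2_comp I J J Rall G1 (fun _ x => x) q); trivial; apply cont2_snd.
  + apply (cont2_comp I J J Rall G2 (fun _ x => x) q); trivial; apply cont2_snd.
Qed.

(** * Integrals and extension to the boundary *)

Lemma ex_RInt_cont1 (a b : R) (f : R -> R) (x y : R) :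
  cont1 (Icc a b) f -> Icc a b x -> Icc a b y -> ex_RInt f x y.
Proof.
intros Hf Hx Hy.
assert (Hab : a <= b) by (unfold Icc in Hx; lra).
apply (ex_RInt_ext (fun z => f (clamp a b z))).
- intros z Hz; rewrite clamp_id; trivial.
  unfold Icc, Rmin, Rmax in *; destruct (Rle_dec x y); lra.
- apply (ex_RInt_continuous (V := R_CompleteNormedModule)); intros z _.
  apply cont1_clamp; trivial.
Qed.

Lemma deriv_at_RInt (a b : R) (f : R -> R) (x : R) :
  cont1 (Icc a b) f -> Icc a b x ->
  deriv_at (Icc a b) (fun y => RInt f a y) x (f x).
Proof.
intros Hf Hx.
assert (Hab : a <= b) by (unfold Icc in Hx; lra).
set (g := fun z => f (clamp a b z)).
assert (Hg : forall z, continuous g z) by (intros z; apply cont1_clamp; trivial).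
apply (deriv_at_ext _ (fun y => RInt g a y) _ x (g x)); trivial.
- intros y Hy; apply RInt_ext; intros z Hz; unfold g; rewrite clamp_id; trivial.
  unfold Icc, Rmin, Rmax in *; destruct (Rle_dec a y); lra.
- unfold g; rewrite clamp_id; trivial.
- apply is_derive_deriv_at.
  apply (is_derive_RInt g (fun y => RInt g a y) a x); [| apply Hg].
  apply filter_forall; intros y; apply (RInt_correct (V := R_CompleteNormedModule)).
  apply (ex_RInt_continuous (V := R_CompleteNormedModule)); auto.
Qed.

Lemma deriv_at_plus (I : R -> Prop) (f g : R -> R) (x k l : R) :
  deriv_at I f x k -> deriv_at I g x l -> deriv_at I (fun y => f y + g y) x (k + l).
Proof.
intros Hf Hg eps He.
destruct (Hf (eps / 2)) as [d1 [Hd1 D1]]; [lra |].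
destruct (Hg (eps / 2)) as [d2 [Hd2 D2]]; [lra |].
exists (Rmin d1 d2); split; [apply Rmin_pos; trivial |]; intros y Hy Dy.
specialize (D1 y Hy (Rlt_le_trans _ _ _ Dy (Rmin_l _ _))).
specialize (D2 y Hy (Rlt_le_trans _ _ _ Dy (Rmin_r _ _))).
replace (f y + g y - (f x + g x) - (k + l) * (y - x))
  with ((f y - f x - k * (y - x)) + (g y - g x - l * (y - x))) by ring.
eapply Rle_trans; [apply Rabs_triang |]; lra.
Qed.

Lemma deriv_at_opp (I : R -> Prop) (f : R -> R) (x l : R) :
  deriv_at I f x l -> deriv_at I (fun y => - f y) x (- l).
Proof.
intros Hf eps He; destruct (Hf eps He) as [d [Hd D]].
exists d; split; trivial; intros y Hy Dy.
replace (- f y - - f x - - l * (y - x)) with (- (f y - f x - l * (y - x))) by ring.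
rewrite Rabs_Ropp; auto.
Qed.

Lemma deriv_at_minus (I : R -> Prop) (f g : R -> R) (x k l : R) :
  deriv_at I f x k -> deriv_at I g x l -> deriv_at I (fun y => f y - g y) x (k - l).
Proof.
intros Hf Hg; apply deriv_at_plus; trivial; apply deriv_at_opp; trivial.
Qed.

Lemma deriv_at_const (I : R -> Prop) (c x : R) : deriv_at I (fun _ => c) x 0.
Proof.
apply is_derive_deriv_at; auto_derive; trivial.
Qed.

(** The mean value theorem for [RInt df a y - f y], whose derivative along the interval is
    [df y - df y], covers the endpoints too. *)
Lemma RInt_deriv_at (a b : R) (f df : R -> R) (x : R) :
  (forall y, Icc a b y -> deriv_at (Icc a b) f y (df y)) -> cont1 (Icc a b) df ->
  Icc a b x -> RInt df a x = f x - f a.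
Proof.
intros Hf Hdf Hx.
destruct (Req_dec a b) as [E | N].
{ unfold Icc in Hx; replace x with a by lra.
  rewrite RInt_point; unfold zero; simpl; ring. }
assert (Hab : a < b) by (unfold Icc in Hx; lra).
assert (Ha : Icc a b a) by (unfold Icc; lra).
destruct (MVT_in (Icc a b) (fun y => RInt df a y - f y) (fun y => df y - df y) a x)
  as [c [_ [_ Ec]]]; trivial.
- apply interval_Icc; trivial.
- intros y Hy; apply deriv_at_minus; auto; apply deriv_at_RInt; trivial.
- rewrite RInt_point in Ec; unfold zero in Ec; simpl in Ec; lra.
Qed.

Lemma cont2_uniform (a b c d : R) (f : R -> R -> R) :
  a <= b -> c <= d -> cont2 (Icc a b) (Icc c d) f ->
  forall eps, 0 < eps -> exists r, 0 < r /\
    forall x y x' y', Icc a b x -> Icc c d y -> Icc a b x' -> Icc c d y' ->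
      Rabs (x' - x) < r -> Rabs (y' - y) < r -> Rabs (f x' y' - f x y) < eps.
Proof.
intros Hab Hcd Hf eps He.
destruct (uniform_continuity_2d (fun x y => f (clamp a b x) (clamp c d y)) a b c d)
  with (eps := mkposreal _ He) as [r Hr].
- intros x y Hx Hy e.
  destruct (Hf (clamp a b x) (clamp c d y) (clamp_in a b x Hab) (clamp_in c d y Hcd)
    e (cond_pos e)) as [r [Hr D]].
  exists (mkposreal _ Hr); intros x' y' Dx Dy; simpl in Dx, Dy.
  apply D; try apply clamp_in; trivial.
  + exact (Rle_lt_trans _ _ _ (clamp_lipschitz _ _ _ _) Dx).
  + exact (Rle_lt_trans _ _ _ (clamp_lipschitz _ _ _ _) Dy).
- exists r; split; [apply cond_pos |]; intros x y x' y' Hx Hy Hx' Hy' Dx Dy.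
  specialize (Hr x y x' y' Hx Hy Hx' Hy' Dx Dy); simpl in Hr.
  rewrite !clamp_id in Hr; trivial.
Qed.

(** For each [y] a mean value in [s] turns the error of the integrand into an oscillation of [f1].
    Uniform continuity on the compact rectangle makes it at most [eps / (d - c)] for all [y] at
    once, and the integration range has length at most [d - c]. *)
Lemma deriv_at_RInt_param (a b c d : R) (f f1 : R -> R -> R) (t x : R) :
  a < b -> c < d ->
  (forall s y, Icc a b s -> Icc c d y -> deriv_at (Icc a b) (fun s => f s y) s (f1 s y)) ->
  (forall s, Icc a b s -> cont1 (Icc c d) (f s)) ->
  cont2 (Icc a b) (Icc c d) f1 -> Icc a b t -> Icc c d x ->
  deriv_at (Icc a b) (fun s => RInt (f s) c x) t (RInt (f1 t) c x).
Proof.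
intros Hab Hcd Hd Hf Hf1 Ht Hx eps He.
assert (Hc : Icc c d c) by (unfold Icc; lra).
destruct (cont2_uniform a b c d f1 (Rlt_le _ _ Hab) (Rlt_le _ _ Hcd) Hf1 (eps / (d - c)))
  as [r [Hr U]]; [apply Rdiv_lt_0_compat; lra |].
exists r; split; trivial; intros s Hs Ds.
assert (X1 : forall s, Icc a b s -> ex_RInt (f s) c x).
{ intros s' Hs'; apply (ex_RInt_cont1 c d); auto. }
assert (X2 : ex_RInt (f1 t) c x).
{ apply (ex_RInt_cont1 c d); trivial; apply (cont2_slice2 (Icc a b)); trivial. }
assert (X3 : ex_RInt (fun y => f s y - f t y) c x).
{ apply (ex_RInt_minus (V := R_NormedModule)); auto. }
assert (X4 : ex_RInt (fun y => (s - t) * f1 t y) c x).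
{ apply (ex_RInt_scal (V := R_NormedModule)); auto. }
assert (E : RInt (f s) c x - RInt (f t) c x - RInt (f1 t) c x * (s - t)
  = RInt (fun y => (f s y - f t y) - (s - t) * f1 t y) c x).
{ rewrite (RInt_minus (V := R_CompleteNormedModule) (fun y => f s y - f t y)
    (fun y => (s - t) * f1 t y)) by trivial.
  rewrite (RInt_minus (V := R_CompleteNormedModule) (f s) (f t)) by auto.
  rewrite (RInt_scal (V := R_CompleteNormedModule) (f1 t)) by trivial.
  unfold minus, plus, opp, scal; simpl; unfold mult; simpl; ring. }
rewrite E.
apply Rle_trans with ((x - c) * (eps / (d - c) * Rabs (s - t))).
- apply abs_RInt_le_const; [unfold Icc in Hx; lra | |].
  + apply (ex_RInt_minus (V := R_NormedModule)); trivial.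
  + intros y Hy.
    assert (Hy' : Icc c d y) by (unfold Icc in *; lra).
    destruct (MVT_in (Icc a b) (fun s => f s y) (fun s => f1 s y) t s) as [z [Hz [Bz Ez]]];
      auto using interval_Icc.
    rewrite Ez; replace (f1 z y * (s - t) - (s - t) * f1 t y)
      with ((f1 z y - f1 t y) * (s - t)) by ring.
    rewrite Rabs_mult; apply Rmult_le_compat_r; [apply Rabs_pos |].
    left; apply U; trivial.
    * exact (Rle_lt_trans _ _ _ (between_dist _ _ _ Bz) Ds).
    * rewrite Rminus_diag, Rabs_R0; trivial.
- apply Rle_trans with ((d - c) * (eps / (d - c) * Rabs (s - t))).
  + apply Rmult_le_compat_r; [| unfold Icc in Hx; lra].
    apply Rmult_le_pos; [left; apply Rdiv_lt_0_compat; lra | apply Rabs_pos].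
  + right; field; lra.
Qed.

(* Differentiate [f t x = f t c + RInt (f2 t) c x] in [t], then in [x]; unlike
   the classical theorem this also reaches the boundary. *)
Lemma C1_pair_schwarz (a b c d : R) (f f1 f2 f11 f12 f21 f22 : R -> R -> R) (t x : R) :
  a < b -> c < d ->
  C1_pair (Icc a b) (Icc c d) f f1 f2 ->
  C1_pair (Icc a b) (Icc c d) f1 f11 f12 ->
  C1_pair (Icc a b) (Icc c d) f2 f21 f22 ->
  Icc a b t -> Icc c d x -> f12 t x = f21 t x.
Proof.
intros Hab Hcd Hf Hf1 Hf2 Ht Hx.
assert (IA := interval_Icc a b Hab); assert (IC := interval_Icc c d Hcd).
assert (Hc : Icc c d c) by (unfold Icc; lra).
assert (C2 := C1_pair_cont _ _ _ _ _ IA IC Hf2).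
assert (E : forall y, Icc c d y -> f1 t y = f1 t c + RInt (f21 t) c y).
{ intros y Hy.
  apply (deriv_at_unique (Icc a b) (fun s => f s y) t); trivial.
  - apply (C1_pair_d1 _ _ _ _ _ Hf); trivial.
  - apply (deriv_at_ext _ (fun s => f s c + RInt (f2 s) c y) _ t
      (f1 t c + RInt (f21 t) c y)); trivial.
    + intros s Hs; rewrite (RInt_deriv_at c d (fun y => f s y)); trivial.
      * ring.
      * intros z Hz; apply (C1_pair_d2 _ _ _ _ _ Hf); trivial.
      * apply (cont2_slice2 (Icc a b)); trivial.
    + apply deriv_at_plus; [apply (C1_pair_d1 _ _ _ _ _ Hf); trivial |].
      apply (deriv_at_RInt_param a b c d f2 f21); trivial.
      * apply (C1_pair_d1 _ _ _ _ _ Hf2).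
      * intros s Hs; apply (cont2_slice2 (Icc a b)); trivial.
      * apply (C1_pair_cont1 _ _ _ _ _ Hf2). }
apply (deriv_at_unique (Icc c d) (fun y => f1 t y) x); trivial.
- apply (C1_pair_d2 _ _ _ _ _ Hf1); trivial.
- apply (deriv_at_ext _ (fun y => f1 t c + RInt (f21 t) c y) _ x (0 + f21 t x)); trivial.
  + intros y Hy; symmetry; auto.
  + ring.
  + apply deriv_at_plus; [apply deriv_at_const |].
    apply deriv_at_RInt; trivial.
    apply (cont2_slice2 (Icc a b)); trivial; apply (C1_pair_cont1 _ _ _ _ _ Hf2).
Qed.

Lemma cont1_eq_closure (a b : R) (f g : R -> R) :
  a < b -> cont1 (Icc a b) f -> cont1 (Icc a b) g ->
  (forall x, Ioo a b x -> f x = g x) -> forall x, Icc a b x -> f x = g x.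
Proof.
intros Hab Hf Hg E x Hx.
destruct (Req_dec (f x) (g x)) as [Exy | N]; [exact Exy | exfalso].
assert (Hp : 0 < Rabs (f x - g x) / 2).
{ assert (0 < Rabs (f x - g x)) by (apply Rabs_pos_lt; lra); lra. }
destruct (Hf x Hx _ Hp) as [d1 [Hd1 D1]]; destruct (Hg x Hx _ Hp) as [d2 [Hd2 D2]].
assert (Hy : exists y, Ioo a b y /\ Rabs (y - x) < Rmin d1 d2).
{ assert (Hd : 0 < Rmin d1 d2) by (apply Rmin_pos; trivial).
  (* A step from [x] toward the midpoint lands strictly inside, even from an endpoint. Since [c] is
     within [(b - a) / 2] of [x], the step is at most half of [Rmin d1 d2]. *)
  set (c := (a + b) / 2).
  set (s := Rmin (1 / 2) (Rmin d1 d2 / (b - a))).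
  assert (Hs : 0 < s) by (apply Rmin_pos; [lra | apply Rdiv_lt_0_compat; lra]).
  assert (s <= 1 / 2) by apply Rmin_l.
  assert (Hs2 : s * (b - a) <= Rmin d1 d2).
  { apply Rle_trans with (Rmin d1 d2 / (b - a) * (b - a)).
    - apply Rmult_le_compat_r; [lra | apply Rmin_r].
    - right; field; lra. }
  exists (x + s * (c - x)); unfold Ioo, Icc in *; split.
  - unfold c; split; nra.
  - replace (x + s * (c - x) - x) with (s * (c - x)) by ring.
    unfold c; apply Rabs_def1; nra. }
destruct Hy as [y [Iy By]].
assert (Hy : Icc a b y) by (unfold Icc, Ioo in *; lra).
specialize (D1 y Hy (Rlt_le_trans _ _ _ By (Rmin_l _ _))).
specialize (D2 y Hy (Rlt_le_trans _ _ _ By (Rmin_r _ _))).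
rewrite (E y Iy) in D1.
pose proof (Rabs_triang (g y - g x) (- (g y - f x))) as Tr.
rewrite Rabs_Ropp in Tr.
replace (g y - g x + - (g y - f x)) with (f x - g x) in Tr by ring.
lra.
Qed.

(** Two one-variable extensions: in [y] on each line with interior [x], then in [x] for every
    [y]. *)
Lemma cont2_eq_closure (a b c d : R) (f g : R -> R -> R) :
  a < b -> c < d -> cont2 (Icc a b) (Icc c d) f -> cont2 (Icc a b) (Icc c d) g ->
  (forall x y, Ioo a b x -> Ioo c d y -> f x y = g x y) ->
  forall x y, Icc a b x -> Icc c d y -> f x y = g x y.
Proof.
intros Hab Hcd Hf Hg E x y Hx Hy.
apply (cont1_eq_closure a b (fun x => f x y) (fun x => g x y)); trivial.
- apply (cont2_slice1 _ (Icc c d)); trivial.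
- apply (cont2_slice1 _ (Icc c d)); trivial.
- clear x Hx; intros x Hx.
  assert (Hx' : Icc a b x) by (unfold Icc, Ioo in *; lra).
  apply (cont1_eq_closure c d (f x) (g x)); auto.
  + apply (cont2_slice2 (Icc a b)); trivial.
  + apply (cont2_slice2 (Icc a b)); trivial.
Qed.

(** * The envelope theorem *)

Section Legendre.

Variables h dh : R -> R.
Hypothesis h_derive : forall p, is_derive h p (dh p).
Hypothesis dh_cont : continuity dh.
Hypothesis dh_incr : forall p q, p < q -> dh p < dh q.
Hypothesis h_super : is_lim (fun p => h p / Rabs p) p_infty p_infty /\
  is_lim (fun p => h p / Rabs p) m_infty p_infty.

Lemma h_MVT (p q : R) : exists c, Rmin p q <= c <= Rmax p q /\ h q - h p = dh c * (q - p).
Proof.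
apply MVT_gen.
- intros; apply h_derive.
- intros x _; apply continuity_pt_filterlim.
  apply (ex_derive_continuous h); exists (dh x); apply h_derive.
Qed.

Lemma dh_le (p q : R) : p <= q -> dh p <= dh q.
Proof.
intros [L | ->]; [left; auto | lra].
Qed.

Lemma h_tangent (p q : R) : h p + dh p * (q - p) <= h q.
Proof.
destruct (h_MVT p q) as [c [Hc Ec]]; revert Hc; unfold Rmin, Rmax.
destruct (Rle_dec p q) as [L | L]; intros Hc.
- assert (dh p <= dh c) by (apply dh_le; lra); nra.
- assert (dh c <= dh p) by (apply dh_le; lra); nra.
Qed.

(** Superlinear growth makes the mean slopes of [h] from 0 unbounded above on the right and below on
    the left. Mean values give points where [dh] is on either side of [v], and the intermediate
    value theorem concludes. *)
Lemma dh_surj (v : R) : exists p, dh p = v.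
Proof.
destruct h_super as [Hp Hm].
(* The points chosen below satisfy [Rabs p >= 1], so [h 0] costs at most [Rabs (h 0) * Rabs p], and
   [h p - h 0] still exceeds [(Rabs v + 1) * Rabs p]. *)
set (K := Rabs (h 0) + Rabs v + 1).
assert (B0 := Rle_abs (h 0)); assert (Bv := Rle_abs v).
assert (Bv' := Rle_abs (- v)); rewrite Rabs_Ropp in Bv'.
assert (Pv := Rabs_pos v); assert (P0 := Rabs_pos (h 0)).
assert (Hub : exists b, v < dh b).
{ apply is_lim_spec in Hp; destruct (Hp K) as [M HM].
  set (p := Rmax 1 (M + 1)).
  assert (L1 : 1 <= p) by apply Rmax_l; assert (L2 : M + 1 <= p) by apply Rmax_r.
  assert (HK : K < h p / Rabs p) by (apply HM; lra).
  rewrite Rabs_pos_eq in HK by lra.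
  assert (HK' : K * p < h p).
  { replace (h p) with (h p / p * p) by (field; lra).
    apply Rmult_lt_compat_r; lra. }
  destruct (h_MVT 0 p) as [c [_ Ec]]; exists c.
  unfold K in HK'; nra. }
assert (Hlb : exists a, dh a < v).
{ apply is_lim_spec in Hm; destruct (Hm K) as [M HM].
  set (p := Rmin (- 1) (M - 1)).
  assert (L1 : p <= - 1) by apply Rmin_l; assert (L2 : p <= M - 1) by apply Rmin_r.
  assert (HK : K < h p / Rabs p) by (apply HM; lra).
  rewrite Rabs_left in HK by lra.
  assert (HK' : K * (- p) < h p).
  { replace (h p) with (h p / - p * - p) by (field; lra).
    apply Rmult_lt_compat_r; lra. }
  destruct (h_MVT 0 p) as [c [_ Ec]]; exists c.
  unfold K in HK'; nra. }
destruct Hub as [b Hb]; destruct Hlb as [a Ha].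
destruct (IVT_gen dh a b v dh_cont) as [p [_ Ep]].
- unfold Rmin, Rmax; destruct (Rle_dec (dh a) (dh b)); lra.
- exists p; exact Ep.
Qed.

(** The inverse of a strictly increasing function is continuous. It is used to show that the
    maximizer moves little when [j] or [m] does. *)
Lemma dh_inv_cont (p : R) (eps : R) : 0 < eps -> exists d, 0 < d /\
  forall q, Rabs (dh q - dh p) < d -> Rabs (q - p) < eps.
Proof.
intros He.
assert (I1 : dh (p - eps) < dh p) by (apply dh_incr; lra).
assert (I2 : dh p < dh (p + eps)) by (apply dh_incr; lra).
exists (Rmin (dh p - dh (p - eps)) (dh (p + eps) - dh p)); split.
{ apply Rmin_pos; lra. }
intros q Dq.
assert (D1 := Rlt_le_trans _ _ _ Dq (Rmin_l _ _)); apply Rabs_def2 in D1.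
assert (D2 := Rlt_le_trans _ _ _ Dq (Rmin_r _ _)); apply Rabs_def2 in D2.
apply Rabs_def1.
- destruct (Rlt_dec (q - p) eps) as [L | L]; trivial.
  assert (dh (p + eps) <= dh q) by (apply dh_le; lra); lra.
- destruct (Rlt_dec (- eps) (q - p)) as [L | L]; trivial.
  assert (dh q <= dh (p - eps)) by (apply dh_le; lra); lra.
Qed.

(** For [h := H x] this is [real (F H x j m)] by conversion, so its derivatives are those taken in
    [Fj] and [Fm]. *)
Definition conj_value (j m : R) : R := real (Lub_Rbar (fun y => exists p, y = - j * p - m * h p)).

(** The objective is concave in [p] for positive [m], so a critical point is a global maximizer; the
    tangent line below [h] shows it directly. *)
Lemma conj_value_attained (j m p : R) :
  0 < m -> m * dh p = - j -> conj_value j m = - j * p - m * h p.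
Proof.
intros Hm E; unfold conj_value.
rewrite (is_lub_Rbar_unique _ (Finite (- j * p - m * h p))); [reflexivity |].
split.
- intros y [q ->]; simpl.
  assert (T := h_tangent p q).
  assert (m * (h p + dh p * (q - p)) <= m * h q) by (apply Rmult_le_compat_l; lra).
  replace (m * (h p + dh p * (q - p))) with (m * h p + (m * dh p) * (q - p)) in H by ring.
  rewrite E in H; lra.
- intros b Hb; apply Hb; exists p; reflexivity.
Qed.

(** Being a supremum is not enough here: [real] sends an infinite one to 0. Surjectivity of [dh]
    gives a maximizer, hence finiteness. *)
Lemma conj_value_ge (j m p : R) : 0 < m -> - j * p - m * h p <= conj_value j m.
Proof.
intros Hm; destruct (dh_surj (- j / m)) as [q Eq].
assert (E : m * dh q = - j) by (rewrite Eq; field; lra).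
rewrite (conj_value_attained j m q Hm E).
assert (T := h_tangent q p).
assert (m * (h q + dh q * (p - q)) <= m * h p) by (apply Rmult_le_compat_l; lra).
replace (m * (h q + dh q * (p - q))) with (m * h q + (m * dh q) * (p - q)) in H by ring.
rewrite E in H; lra.
Qed.

(* For [S] a supremum of functions affine in the parameter, [a] and [b] are the
   slopes of maximizers at [s] and at [r]. *)
Lemma is_derive_envelope (S : R -> R) (s a : R) :
  (forall eps, 0 < eps -> exists d, 0 < d /\ forall r, Rabs (r - s) < d ->
     exists b, Rabs (b - a) < eps /\ (r - s) * a <= S r - S s <= (r - s) * b) ->
  is_derive S s a.
Proof.
intros HS; apply is_derive_Reals; intros eps He.
destruct (HS eps He) as [d [Hd D]]; exists (mkposreal _ Hd); intros r Hr Dr; simpl in Dr.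
destruct (D (s + r)) as [b [Bb [L U]]].
{ replace (s + r - s) with r by ring; trivial. }
replace (s + r - s) with r in * by ring.
apply Rabs_def2 in Bb.
(* The hypothesis puts [S (s + r) - S s - r * a] between 0 and [r * (b - a)], so for either sign of
   [r] the quotient is at most [Rabs (b - a)] in absolute value. *)
replace ((S (s + r) - S s) / r - a) with ((S (s + r) - S s - r * a) / r) by (field; trivial).
apply Rabs_def1.
- apply (Rle_lt_trans _ (Rabs (b - a))); [| apply Rabs_def1; lra].
  apply Rle_trans with (Rabs ((S (s + r) - S s - r * a) / r)); [apply Rle_abs |].
  unfold Rdiv; rewrite Rabs_mult, Rabs_inv.
  apply (Rmult_le_reg_r (Rabs r)); [apply Rabs_pos_lt; trivial |].
  rewrite Rmult_assoc, Rinv_l, Rmult_1_r by (apply Rabs_no_R0; trivial).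
  rewrite <- Rabs_mult, Rabs_pos_eq by lra.
  apply Rle_trans with ((b - a) * r); [lra | apply Rle_abs].
- apply Ropp_lt_cancel; rewrite Ropp_involutive.
  apply (Rle_lt_trans _ (Rabs (b - a))); [| apply Rabs_def1; lra].
  apply Rle_trans with (Rabs ((S (s + r) - S s - r * a) / r)).
  { rewrite <- Rabs_Ropp; apply Rle_abs. }
  unfold Rdiv; rewrite Rabs_mult, Rabs_inv.
  apply (Rmult_le_reg_r (Rabs r)); [apply Rabs_pos_lt; trivial |].
  rewrite Rmult_assoc, Rinv_l, Rmult_1_r by (apply Rabs_no_R0; trivial).
  rewrite <- Rabs_mult, Rabs_pos_eq by lra.
  apply Rle_trans with ((b - a) * r); [lra | apply Rle_abs].
Qed.

(** Testing the supremum at [k] with the old maximizer [p], and the one at [j] with the new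
    maximizer [q], encloses the increment between slopes [- p] and [- q]. The radius [m * d]
    reflects [m * (dh q - dh p) = - (k - j)]. *)
Lemma conj_value_derive_j (j m p : R) :
  0 < m -> m * dh p = - j -> is_derive (fun k => conj_value k m) j (- p).
Proof.
intros Hm E; apply is_derive_envelope; intros eps He.
destruct (dh_inv_cont p eps He) as [d [Hd D]].
exists (m * d); split; [apply Rmult_lt_0_compat; trivial |]; intros k Hk.
destruct (dh_surj (- k / m)) as [q Eq].
assert (E' : m * dh q = - k) by (rewrite Eq; field; lra).
exists (- q); split; [| split].
- replace (- q - - p) with (- (q - p)) by ring; rewrite Rabs_Ropp; apply D.
  apply (Rmult_lt_reg_l m); trivial.
  rewrite <- (Rabs_pos_eq m) at 1 by lra; rewrite <- Rabs_mult.
  replace (m * (dh q - dh p)) with (m * dh q - m * dh p) by ring.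
  rewrite E, E'; replace (- k - - j) with (- (k - j)) by ring; rewrite Rabs_Ropp; trivial.
- assert (L := conj_value_ge k m p Hm); rewrite (conj_value_attained j m p Hm E); lra.
- assert (L := conj_value_ge j m q Hm); rewrite (conj_value_attained k m q Hm E'); lra.
Qed.

Lemma conj_value_derive_m (j m p : R) :
  0 < m -> m * dh p = - j -> is_derive (fun n => conj_value j n) m (- h p).
Proof.
intros Hm E; apply is_derive_envelope; intros eps He.
assert (Ch : continuous h p).
{ apply (ex_derive_continuous h); exists (dh p); apply h_derive. }
assert (HB : locally (h p) (fun y => Rabs (y - h p) < eps)).
{ exists (mkposreal _ He); intros y Hy; exact Hy. }
destruct (Ch _ HB) as [r Hr].
destruct (dh_inv_cont p r (cond_pos r)) as [d [Hd D]].
assert (Pj := Rabs_pos (dh p)).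
(* The first bound keeps [n] above [m / 2]. The second uses [n * (dh q - dh p) = - ((n - m) * dh p)]
   to bring [dh q] within [d] of [dh p]; the added 1 keeps the denominator positive. *)
set (e := Rmin (m / 2) (m / 2 * d / (Rabs (dh p) + 1))).
exists e; split.
{ apply Rmin_pos; [lra |]; apply Rdiv_lt_0_compat; nra. }
intros n Hn.
assert (N1 := Rlt_le_trans _ _ _ Hn (Rmin_l _ _)).
assert (N2 := Rlt_le_trans _ _ _ Hn (Rmin_r _ _)).
assert (Hn' : m / 2 < n) by (apply Rabs_def2 in N1; lra).
destruct (dh_surj (- j / n)) as [q Eq].
assert (E' : n * dh q = - j) by (rewrite Eq; field; lra).
assert (Hqp : Rabs (dh q - dh p) < d).
{ assert (N3 : Rabs (n - m) * (Rabs (dh p) + 1) < m / 2 * d).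
  { replace (m / 2 * d) with (m / 2 * d / (Rabs (dh p) + 1) * (Rabs (dh p) + 1)) by (field; lra).
    apply Rmult_lt_compat_r; lra. }
  assert (E2 : n * (dh q - dh p) = - ((n - m) * dh p)) by lra.
  assert (E3 : n * Rabs (dh q - dh p) = Rabs (n - m) * Rabs (dh p)).
  { rewrite <- (Rabs_pos_eq n) at 1 by lra.
    rewrite <- Rabs_mult, E2, Rabs_Ropp, Rabs_mult; reflexivity. }
  assert (Pn := Rabs_pos (n - m)); assert (Pq := Rabs_pos (dh q - dh p)).
  nra. }
exists (- h q); split; [| split].
- replace (- h q - - h p) with (- (h q - h p)) by ring; rewrite Rabs_Ropp.
  apply (Hr q); exact (D q Hqp).
- assert (L := conj_value_ge j n p); rewrite (conj_value_attained j m p Hm E); lra.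
- assert (L := conj_value_ge j m q Hm); rewrite (conj_value_attained j n q ltac:(lra) E'); lra.
Qed.

End Legendre.

(** * Equivalence of the two problems *)

Lemma C1_pair_minus (I J : R -> Prop) (f f1 f2 g g1 g2 : R -> R -> R) :
  C1_pair I J f f1 f2 -> C1_pair I J g g1 g2 ->
  C1_pair I J (fun x y => f x y - g x y) (fun x y => f1 x y - g1 x y) (fun x y => f2 x y - g2 x y).
Proof.
intros [D1 D2 K1 K2] [E1 E2 L1 L2]; split; try (apply cont2_minus; trivial).
- intros x y Hx Hy; apply (deriv_at_minus I (fun s => f s y) (fun s => g s y)); auto.
- intros x y Hx Hy; apply (deriv_at_minus J (fun s => f x s) (fun s => g x s)); auto.
Qed.

Lemma RInt_opp_ext (a b : R) (f g : R -> R) (x : R) :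
  cont1 (Icc a b) f -> (forall y, Icc a b y -> g y = - f y) -> Icc a b x ->
  - RInt g a x = RInt f a x.
Proof.
intros Hf E Hx.
assert (Ha : Icc a b a) by (unfold Icc in *; lra).
rewrite (RInt_ext g (fun y => - f y)).
- rewrite (RInt_opp (V := R_CompleteNormedModule) f).
  + unfold opp; simpl; ring.
  + apply (ex_RInt_cont1 a b); trivial.
- intros y Hy; apply E; unfold Icc, Rmin, Rmax in *; destruct (Rle_dec a x); lra.
Qed.

Lemma C1_on_cont1 (I : R -> Prop) (f : R -> R) : interval I -> C1_on I f -> cont1 I f.
Proof.
intros HI [Hf _]; apply (deriv_at_cont1 I f (Derive_in I f)).
intros x Hx; apply Derive_in_deriv_at; auto.
Qed.

Lemma phi0_left (T : R) (m0 mT : R -> R) (t : R) : phi0 T m0 mT t 0 = 0.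
Proof.
unfold phi0; rewrite !RInt_point; unfold zero; simpl; ring.
Qed.

Lemma phi0_right (T : R) (m0 mT : R -> R) (t : R) :
  0 < T -> RInt m0 0 1 = 1 -> RInt mT 0 1 = 1 -> phi0 T m0 mT t 1 = 1.
Proof.
intros hT E0 ET; unfold phi0; rewrite E0, ET; field; lra.
Qed.

Lemma phi0_initial (T : R) (m0 mT : R -> R) (x : R) : 0 < T -> phi0 T m0 mT 0 x = RInt m0 0 x.
Proof.
intros hT; unfold phi0; field; lra.
Qed.

Lemma phi0_final (T : R) (m0 mT : R -> R) (x : R) : 0 < T -> phi0 T m0 mT T x = RInt mT 0 x.
Proof.
intros hT; unfold phi0; field; lra.
Qed.

(** * The Hamiltonian, its maximizers, and the two implications *)

Section Hamiltonian.

Variable H : R -> R -> R.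
Hypothesis hH : C1_on2 (Icc 0 1) Rall H.
Hypothesis hDpH : C1_on2 (Icc 0 1) Rall (DpH H).
Hypothesis hsuper : forall x, Icc 0 1 x ->
  is_lim (fun p => H x p / Rabs p) p_infty p_infty /\
  is_lim (fun p => H x p / Rabs p) m_infty p_infty.
Hypothesis hconv : forall x, Icc 0 1 x -> forall p : R, 0 < DppH H x p.

Let J01 : interval (Icc 0 1) := interval_Icc 0 1 Rlt_0_1.

Lemma is_derive_slice (G : R -> R -> R) (x p : R) :
  C1_on2 (Icc 0 1) Rall G -> Icc 0 1 x ->
  is_derive (fun p => G x p) p (Derive (fun p => G x p) p).
Proof.
intros HG Hx; destruct (C1_on2_ex2 _ _ _ HG x p Hx Logic.I) as [l Hl].
apply is_derive_in_Rall in Hl; apply Derive_correct; exists l; exact Hl.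
Qed.

(** Momenta range over the whole line, so the second partial is the ordinary [Derive]; for [G := H]
    and [G := DpH H] it is [DpH H] and [DppH H] by conversion. *)
Lemma C1_pair_slice (G : R -> R -> R) :
  C1_on2 (Icc 0 1) Rall G ->
  C1_pair (Icc 0 1) Rall G (pd1 (Icc 0 1) G) (fun x p => Derive (fun p => G x p) p).
Proof.
intros HG.
apply (C1_pair_ext _ _ G (pd1 (Icc 0 1) G) (pd2 Rall G)); trivial.
- intros x p Hx _; apply (deriv_at_Derive_in Rall (fun p => G x p)); [apply interval_Rall | exact Logic.I |].
  apply is_derive_deriv_at, is_derive_slice; trivial.
- apply C1_on2_pair; trivial; apply interval_Rall.
Qed.

Lemma DpH_incr (x p q : R) : Icc 0 1 x -> p < q -> DpH H x p < DpH H x q.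
Proof.
intros Hx Hpq.
destruct (MVT_in Rall (fun p => DpH H x p) (fun p => DppH H x p) p q) as [c [_ [_ E]]];
  try exact Logic.I; [apply interval_Rall | |].
- intros z _; apply is_derive_deriv_at; apply (is_derive_slice (DpH H)); trivial.
- assert (P := hconv x Hx c); nra.
Qed.

Lemma DpH_cont (x : R) : Icc 0 1 x -> continuity (fun p => DpH H x p).
Proof.
intros Hx p; apply continuity_pt_filterlim.
apply (ex_derive_continuous (fun p => DpH H x p)); exists (DppH H x p).
apply (is_derive_slice (DpH H)); trivial.
Qed.

Lemma Fj_Fm_eq (x j m p : R) :
  Icc 0 1 x -> 0 < m -> m * DpH H x p = - j -> Fj H x j m = - p /\ Fm H x j m = - H x p.
Proof.
intros Hx Hm E.
assert (D1 : forall p, is_derive (fun p => H x p) p (DpH H x p)).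
{ intros r; apply is_derive_slice; trivial. }
split; apply is_derive_unique.
- apply (conj_value_derive_j (H x) (DpH H x) D1 (DpH_cont x Hx)
    (fun p q => DpH_incr x p q Hx) (hsuper x Hx)); trivial.
- apply (conj_value_derive_m (H x) (DpH H x) D1 (DpH_cont x Hx)
    (fun p q => DpH_incr x p q Hx) (hsuper x Hx)); trivial.
Qed.

Lemma DpH_surj (x v : R) : Icc 0 1 x -> exists p, DpH H x p = v.
Proof.
intros Hx; apply (dh_surj (H x) (DpH H x)); auto.
- intros r; apply is_derive_slice; trivial.
- apply DpH_cont; trivial.
Qed.

Variable T : R.
Hypothesis hT : 0 < T.
Variables m0 mT : R -> R.
Hypothesis hm0 : C1_on (Icc 0 1) m0.
Hypothesis hmT : C1_on (Icc 0 1) mT.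
Hypothesis hm0int : RInt m0 0 1 = 1.
Hypothesis hmTint : RInt mT 0 1 = 1.

Let IT : interval (Icc 0 T) := interval_Icc 0 T hT.
Let Ioo_Icc (a b x : R) : Ioo a b x -> Icc a b x.
Proof.
unfold Ioo, Icc; lra.
Qed.
Let zeroT : Icc 0 T 0.
Proof.
unfold Icc; lra.
Qed.
Let endT : Icc 0 T T.
Proof.
unfold Icc; lra.
Qed.
Let zero1 : Icc 0 1 0.
Proof.
unfold Icc; lra.
Qed.
Let one1 : Icc 0 1 1.
Proof.
unfold Icc; lra.
Qed.

Lemma P2_to_P1 (phi u m : R -> R -> R) :
  P2_classical T H m0 mT phi ->
  (forall t x, Icc 0 T t -> Icc 0 1 x -> 0 < pdx phi t x) ->
  relations T H phi u m -> P1_classical T H m0 mT u m.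
Proof.
intros [Hphi2 _ Hpde Hbd] Hpos Hrel.
set (pt := pdt T phi); set (px := pdx phi).
destruct Hphi2 as [Hphi Hpt Hpx].
apply C1_on2_pair in Hphi; trivial; apply C1_on2_pair in Hpt; trivial.
assert (Hpx' := Hpx); apply C1_on2_pair in Hpx; trivial.
fold (pdt T phi) (pdx phi) pt px in Hphi, Hpt, Hpx, Hpx'.
fold px in Hpos.
set (ptt := pd1 (Icc 0 T) pt) in *; set (ptx := pd2 (Icc 0 1) pt) in *.
set (pxt := pd1 (Icc 0 T) px) in *; set (pxx := pd2 (Icc 0 1) px) in *.
(* Defining [q] through [F_j] avoids choosing a maximizer at each point; [Hq] then identifies it
   with the one given by surjectivity of [DpH]. *)
set (q := fun t x => - Fj_along T H phi t x).
assert (Hq : forall t x, Icc 0 T t -> Icc 0 1 x ->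
  DpH H x (q t x) = pt t x / px t x /\ Fm_along T H phi t x = - H x (q t x)).
{ intros t x Ht Hx; destruct (DpH_surj x (pt t x / px t x) Hx) as [p Ep].
  assert (P := Hpos t x Ht Hx).
  destruct (Fj_Fm_eq x (- pt t x) (px t x) p Hx P) as [EFj EFm].
  { rewrite Ep; field; lra. }
  unfold q, Fj_along, Fm_along; fold pt px; rewrite EFj, EFm, Ropp_involutive; auto. }
assert (HG := C1_pair_slice (DpH H) hDpH).
assert (Cq := C1_pair_implicit (Icc 0 T) (Icc 0 1) (DpH H) _ _ q _ _ _ IT J01 HG (fun x p Hx => hconv x Hx p)
  DpH_incr (C1_pair_div _ _ _ _ _ _ _ _ IT J01 Hpt Hpx Hpos)
  (fun t x Ht Hx => proj1 (Hq t x Ht Hx))).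
match type of Cq with C1_pair _ _ _ ?a ?b => set (q1 := a) in Cq; set (q2 := b) in Cq end.
assert (Ch := C1_pair_along _ _ _ _ _ _ _ _ IT J01 (C1_pair_slice H hH) Cq).
match type of Ch with C1_pair _ _ ?a _ ?b => set (h := a) in Ch; set (h2 := b) in Ch end.
assert (Kq := C1_pair_cont _ _ _ _ _ IT J01 Cq).
assert (Kh := C1_pair_cont _ _ _ _ _ IT J01 Ch).
assert (Kpx := C1_pair_cont _ _ _ _ _ IT J01 Hpx).
(* With [q] of class C^1 both sides are continuous, so the equation reaches the edges, including
   [t = 0] and [t = T], where [u_t] is needed as well. *)
assert (Epde : forall t x, Icc 0 T t -> Icc 0 1 x -> q1 t x = h2 t x - px t x).
{ apply cont2_eq_closure; trivial; try lra.
  - apply (C1_pair_cont1 _ _ _ _ _ Cq).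
  - apply cont2_minus; trivial; apply (C1_pair_cont2 _ _ _ _ _ Ch).
  - intros t x Ht' Hx'; assert (Ht := Ioo_Icc _ _ _ Ht'); assert (Hx := Ioo_Icc _ _ _ Hx').
    destruct (Hpde t x Ht' Hx') as [_ [_ E]].
    assert (E1 : pdt T (Fj_along T H phi) t x = - q1 t x).
    { apply deriv_at_Derive_in; trivial.
      apply (deriv_at_ext _ (fun s => - q s x) _ t (- q1 t x)); trivial.
      - intros s _; unfold q; ring.
      - apply deriv_at_opp, (C1_pair_d1 _ _ _ _ _ Cq); trivial. }
    assert (E2 : pdx (fun s y => - Fm_along T H phi s y) t x = h2 t x).
    { apply deriv_at_Derive_in; trivial.
      apply (deriv_at_ext _ (fun y => h t y) _ x (h2 t x)); trivial.
      - intros y Hy; rewrite (proj2 (Hq t y Ht Hy)), Ropp_involutive; reflexivity.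
      - apply (C1_pair_d2 _ _ _ _ _ Ch); trivial. }
    rewrite E1, E2 in E; fold px in E; lra. }
assert (phi_left : forall t, Icc 0 T t -> phi t 0 = 0).
{ intros t Ht; rewrite Hbd; auto; apply phi0_left. }
assert (Eu : forall t x, Icc 0 T t -> Icc 0 1 x ->
  u t x = RInt (q t) 0 x + RInt (fun s => h s 0) 0 t).
{ intros t x Ht Hx; rewrite (proj2 (Hrel t x Ht Hx)); unfold Rminus; f_equal.
  - apply (RInt_opp_ext 0 1); trivial.
    + apply (cont2_slice2 (Icc 0 T)); trivial.
    + intros y _; unfold q; ring.
  - apply (RInt_opp_ext 0 T); trivial.
    + apply (cont2_slice1 _ (Icc 0 1)); trivial.
    + intros s Hs; apply (proj2 (Hq s 0 Hs zero1)). }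
assert (Cu : C1_pair (Icc 0 T) (Icc 0 1) u (fun t x => h t x - phi t x) q).
{ split; trivial.
  - intros t x Ht Hx.
    apply (deriv_at_ext _ (fun s => RInt (q s) 0 x + RInt (fun s => h s 0) 0 s) _ t
      (RInt (q1 t) 0 x + h t 0)); trivial.
    + intros s Hs; symmetry; auto.
    (* By [Epde], [q1] is the [x]-derivative of [h - phi]. Its integral leaves [- h t 0 + phi t 0]
       at the lower end: the first term cancels against the derivative of the second integral in
       [u], and [phi t 0] is 0. *)
    + rewrite (RInt_deriv_at 0 1 (fun y => h t y - phi t y) (q1 t)); trivial.
      * rewrite (phi_left t Ht); ring.
      * intros y Hy; rewrite Epde; trivial; apply deriv_at_minus.
        -- apply (C1_pair_d2 _ _ _ _ _ Ch); trivial.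
        -- apply (C1_pair_d2 _ _ _ _ _ Hphi); trivial.
      * apply (cont2_slice2 (Icc 0 T)); trivial; apply (C1_pair_cont1 _ _ _ _ _ Cq).
    + apply deriv_at_plus.
      * apply (deriv_at_RInt_param 0 T 0 1 q q1); trivial; try lra.
        -- apply (C1_pair_d1 _ _ _ _ _ Cq).
        -- intros s Hs; apply (cont2_slice2 (Icc 0 T)); trivial.
        -- apply (C1_pair_cont1 _ _ _ _ _ Cq).
      * apply (deriv_at_RInt 0 T (fun s => h s 0)); trivial.
        apply (cont2_slice1 _ (Icc 0 1)); trivial.
  - intros t x Ht Hx.
    apply (deriv_at_ext _ (fun y => RInt (q t) 0 y + RInt (fun s => h s 0) 0 t) _ x
      (q t x + 0)); trivial; [intros y Hy; symmetry; auto | ring |].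
    apply deriv_at_plus; [| apply deriv_at_const].
    apply deriv_at_RInt; trivial; apply (cont2_slice2 (Icc 0 T)); trivial.
  - apply cont2_minus; trivial; exact (C1_pair_cont _ _ _ _ _ IT J01 Hphi). }
assert (Eut : forall t x, Icc 0 T t -> Icc 0 1 x -> pdt T u t x = h t x - phi t x).
{ intros t x Ht Hx; apply (C1_pair_pd1 _ _ _ _ _ t x IT Cu); trivial. }
assert (Eux : forall t x, Icc 0 T t -> Icc 0 1 x -> pdx u t x = q t x).
{ intros t x Ht Hx; apply (C1_pair_pd2 _ _ _ _ _ t x J01 Cu); trivial. }
assert (Em : forall t x, Icc 0 T t -> Icc 0 1 x -> px t x = m t x).
{ intros t x Ht Hx; symmetry; apply (proj1 (Hrel t x Ht Hx)). }
assert (Eflux : forall t x, Icc 0 T t -> Icc 0 1 x ->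
  pt t x = m t x * DpH H x (pdx u t x)).
{ intros t x Ht Hx; rewrite Eux, (proj1 (Hq t x Ht Hx)), <- Em by trivial.
  assert (P := Hpos t x Ht Hx); field; lra. }
split.
- apply (C1_pair_C2_on2 _ _ _ _ _ IT J01 Cu).
  + apply (C1_pair_C1_on2 _ _ _ _ _ IT J01 (C1_pair_minus _ _ _ _ _ _ _ _ Ch Hphi)).
  + apply (C1_pair_C1_on2 _ _ _ _ _ IT J01 Cq).
- apply (C1_on2_ext _ _ px); trivial.
- intros t x Ht Hx; rewrite <- Em by trivial; left; auto.
- intros t x Ht' Hx'; assert (Ht := Ioo_Icc _ _ _ Ht'); assert (Hx := Ioo_Icc _ _ _ Hx').
  rewrite Eut, Eux by trivial.
  rewrite (RInt_deriv_at 0 1 (phi t) (fun y => m t y)); trivial.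
  + rewrite (phi_left t Ht); unfold h; ring.
  + intros y Hy; rewrite <- Em by trivial; apply (C1_pair_d2 _ _ _ _ _ Hphi); trivial.
  + apply (cont2_slice2 (Icc 0 T)); trivial; apply (cont2_ext _ _ px); trivial.
- intros t x Ht' Hx'; assert (Ht := Ioo_Icc _ _ _ Ht'); assert (Hx := Ioo_Icc _ _ _ Hx').
  assert (D : deriv_at (Icc 0 1) (fun y => m t y * DpH H y (pdx u t y)) x (ptx t x)).
  { apply (deriv_at_ext _ (fun y => pt t y) _ x (ptx t x)); auto.
    apply (C1_pair_d2 _ _ _ _ _ Hpt); trivial. }
  split; [exists (ptx t x); apply is_derive_in_eps; trivial |].
  replace (pdx (fun s y => m s y * DpH H y (pdx u s y)) t x) with (ptx t x)
    by (symmetry; apply deriv_at_Derive_in; trivial).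
  replace (pdt T m t x) with (pxt t x).
  + rewrite (C1_pair_schwarz 0 T 0 1 phi pt px ptt ptx pxt pxx t x); trivial; lra.
  + symmetry; apply deriv_at_Derive_in; trivial.
    apply (deriv_at_ext _ (fun s => px s x) _ t (pxt t x)); auto.
    apply (C1_pair_d1 _ _ _ _ _ Hpx); trivial.
- intros x Hx; rewrite <- Em by trivial.
  (* On the edge [t = 0], [phi] is the primitive of [m0]; comparing derivatives along the edge gives
     the initial density, also at the corners. *)
  apply (deriv_at_unique (Icc 0 1) (phi 0) x); trivial.
  + apply (C1_pair_d2 _ _ _ _ _ Hphi); trivial.
  + apply (deriv_at_ext _ (fun y => RInt m0 0 y) _ x (m0 x)); trivial.
    * intros y Hy; rewrite Hbd, phi0_initial; auto.
    * apply deriv_at_RInt; trivial; apply C1_on_cont1; trivial.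
- intros x Hx; rewrite <- Em by trivial.
  apply (deriv_at_unique (Icc 0 1) (phi T) x); trivial.
  + apply (C1_pair_d2 _ _ _ _ _ Hphi); trivial.
  + apply (deriv_at_ext _ (fun y => RInt mT 0 y) _ x (mT x)); trivial.
    * intros y Hy; rewrite Hbd, phi0_final; auto.
    * apply deriv_at_RInt; trivial; apply C1_on_cont1; trivial.
- intros t x Ht' Hx'; assert (Ht := Ioo_Icc _ _ _ Ht').
  assert (Hx : Icc 0 1 x) by (destruct Hx' as [-> | ->]; trivial).
  rewrite <- Ropp_mult_distr_l, <- Eflux by trivial.
  (* The flux is [phi_t], and [phi0] is constant in time on the lateral edges: 0 at [x = 0] and, as
     both masses are 1, 1 at [x = 1]. *)
  replace (pt t x) with 0; [ring |].
  apply (deriv_at_unique (Icc 0 T) (fun s => phi s x) t); trivial.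
  + destruct Hx' as [-> | ->].
    * apply (deriv_at_ext _ (fun _ => 0) _ t 0); trivial; [| apply deriv_at_const].
      intros s Hs; symmetry; auto.
    * apply (deriv_at_ext _ (fun _ => 1) _ t 0); trivial; [| apply deriv_at_const].
      intros s Hs; rewrite Hbd, phi0_right; auto.
  + apply (C1_pair_d1 _ _ _ _ _ Hphi); trivial.
Qed.

Lemma P1_to_P2 (u m : R -> R -> R) :
  P1_classical T H m0 mT u m ->
  (forall t x, Icc 0 T t -> Icc 0 1 x -> 0 < m t x) ->
  u 0 0 = 0 ->
  exists phi : R -> R -> R,
    C2_on2 (Icc 0 T) (Icc 0 1) phi /\ relations T H phi u m /\ P2_classical T H m0 mT phi.
Proof.
intros [Hu2 Hm1 _ HHJ Hcont Hini Hfin Hflux] Hpos Hu0.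
set (ut := pdt T u) in *; set (ux := pdx u) in *.
destruct Hu2 as [Hu Hut Hux].
apply C1_on2_pair in Hu; trivial; apply C1_on2_pair in Hut; trivial.
apply C1_on2_pair in Hux; trivial.
assert (Hm := Hm1); apply C1_on2_pair in Hm; trivial.
fold (pdt T u) (pdx u) ut ux in Hu, Hut, Hux.
set (utt := pd1 (Icc 0 T) ut) in *; set (utx := pd2 (Icc 0 1) ut) in *.
set (uxt := pd1 (Icc 0 T) ux) in *; set (uxx := pd2 (Icc 0 1) ux) in *.
set (m1 := pd1 (Icc 0 T) m) in *; set (m2 := pd2 (Icc 0 1) m) in *.
(* The flux [w] is C^1 because [m], [DpH] and [u_x] are. It becomes the time derivative of [phi],
   whence the C^2 regularity of [phi]. *)
assert (Cw := C1_pair_mult _ _ _ _ _ _ _ _ IT J01 Hm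
  (C1_pair_along _ _ _ _ _ _ _ _ IT J01 (C1_pair_slice (DpH H) hDpH) Hux)).
match type of Cw with C1_pair _ _ ?a _ ?b => set (w := a) in Cw; set (w2 := b) in Cw end.
assert (Kw := C1_pair_cont _ _ _ _ _ IT J01 Cw).
assert (Km := C1_pair_cont _ _ _ _ _ IT J01 Hm).
assert (Kut := C1_pair_cont _ _ _ _ _ IT J01 Hut).
assert (Kux := C1_pair_cont _ _ _ _ _ IT J01 Hux).
assert (Kh : cont2 (Icc 0 T) (Icc 0 1) (fun t x => H x (ux t x))).
{ apply (C1_pair_cont _ _ _ _ _ IT J01
    (C1_pair_along _ _ _ _ _ _ _ _ IT J01 (C1_pair_slice H hH) Hux)). }
assert (Em1 : forall t x, Icc 0 T t -> Icc 0 1 x -> m1 t x = w2 t x).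
{ apply cont2_eq_closure; trivial; try lra.
  - apply (C1_pair_cont1 _ _ _ _ _ Hm).
  - apply (C1_pair_cont2 _ _ _ _ _ Cw).
  - intros t x Ht' Hx'; assert (Ht := Ioo_Icc _ _ _ Ht'); assert (Hx := Ioo_Icc _ _ _ Hx').
    destruct (Hcont t x Ht' Hx') as [_ E].
    replace (w2 t x) with (pdx w t x)
      by (apply (C1_pair_pd2 _ _ _ _ _ t x J01 Cw); trivial).
    change (m1 t x - pdx w t x = 0) in E; lra. }
(* The no-flux condition is given for interior times; continuity adds the four corners. *)
assert (Ew : forall t x, Icc 0 T t -> x = 0 \/ x = 1 -> w t x = 0).
{ intros t x Ht Hx'.
  assert (Hx : Icc 0 1 x) by (destruct Hx' as [-> | ->]; trivial).
  apply (cont1_eq_closure 0 T (fun t => w t x) (fun _ => 0)); trivial.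
  - apply (cont2_slice1 _ (Icc 0 1)); trivial.
  - apply (cont2_slice1 _ (Icc 0 1) (fun _ _ => 0) x); trivial; apply cont2_const.
  - intros s Hs; assert (E := Hflux s x Hs Hx'); unfold w; lra. }
set (phi := fun t x => RInt (m t) 0 x).
assert (Cphi : C1_pair (Icc 0 T) (Icc 0 1) phi w m).
{ split; trivial.
  - intros t x Ht Hx.
    (* The time derivative of [phi] is the integral of [m_t = w_x], that is [w t x - w t 0], and the
       flux vanishes at [x = 0]. *)
    replace (w t x) with (RInt (m1 t) 0 x).
    + apply (deriv_at_RInt_param 0 T 0 1 m m1); trivial; try lra.
      * apply (C1_pair_d1 _ _ _ _ _ Hm).
      * intros s Hs; apply (cont2_slice2 (Icc 0 T)); trivial.
      * apply (C1_pair_cont1 _ _ _ _ _ Hm).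
    + rewrite (RInt_deriv_at 0 1 (w t) (m1 t)); trivial.
      * rewrite (Ew t 0) by auto; apply Rminus_0_r.
      * intros y Hy; rewrite Em1; trivial; apply (C1_pair_d2 _ _ _ _ _ Cw); trivial.
      * apply (cont2_slice2 (Icc 0 T)); trivial; apply (C1_pair_cont1 _ _ _ _ _ Hm).
  - intros t x Ht Hx; apply deriv_at_RInt; trivial.
    apply (cont2_slice2 (Icc 0 T)); trivial. }
assert (Ept : forall t x, Icc 0 T t -> Icc 0 1 x -> pdt T phi t x = w t x).
{ intros t x Ht Hx; apply (C1_pair_pd1 _ _ _ _ _ t x IT Cphi); trivial. }
assert (Epx : forall t x, Icc 0 T t -> Icc 0 1 x -> pdx phi t x = m t x).
{ intros t x Ht Hx; apply (C1_pair_pd2 _ _ _ _ _ t x J01 Cphi); trivial. }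
assert (EF : forall t x, Icc 0 T t -> Icc 0 1 x ->
  Fj_along T H phi t x = - ux t x /\ Fm_along T H phi t x = - H x (ux t x)).
{ intros t x Ht Hx; unfold Fj_along, Fm_along; rewrite Ept, Epx by trivial.
  apply Fj_Fm_eq; auto; unfold w; ring. }
(* The extension to the closed rectangle matters at [x = 0]: there [phi] vanishes, so [F_m] in the
   relations reduces to [- u_t]. *)
assert (EHJ : forall t x, Icc 0 T t -> Icc 0 1 x -> H x (ux t x) = ut t x + phi t x).
{ apply cont2_eq_closure; trivial; try lra.
  - apply cont2_plus; trivial; apply (C1_pair_cont _ _ _ _ _ IT J01 Cphi).
  - intros t x Ht Hx; assert (E := HHJ t x Ht Hx).
    change (- ut t x + H x (ux t x) = phi t x) in E; lra. }
assert (phi_left : forall t, phi t 0 = 0).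
{ intros t; unfold phi; rewrite RInt_point; reflexivity. }
assert (phi_ini : forall x, Icc 0 1 x -> phi 0 x = RInt m0 0 x).
{ intros x Hx; apply RInt_ext; intros y Hy; apply Hini.
  unfold Icc, Rmin, Rmax in *; destruct (Rle_dec 0 x); lra. }
assert (Cphi2 : C2_on2 (Icc 0 T) (Icc 0 1) phi).
{ apply (C1_pair_C2_on2 _ _ _ _ _ IT J01 Cphi); trivial.
  exact (C1_pair_C1_on2 _ _ _ _ _ IT J01 Cw). }
exists phi; split; [| split]; trivial.
- intros t x Ht Hx; split; [symmetry; auto |].
  (* The two integrals become [u t x - u t 0] and [u t 0 - u 0 0]; the normalization of [u] at the
     origin closes the sum. *)
  rewrite (RInt_opp_ext 0 1 (ux t)); trivial.
  2: apply (cont2_slice2 (Icc 0 T)); trivial.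
  2: intros y Hy; apply (proj1 (EF t y Ht Hy)).
  unfold Rminus; rewrite (RInt_opp_ext 0 T (fun s => ut s 0)); trivial.
  2: apply (cont2_slice1 _ (Icc 0 1)); trivial.
  2: { intros s Hs; rewrite (proj2 (EF s 0 Hs zero1)), EHJ, phi_left by trivial; ring. }
  rewrite (RInt_deriv_at 0 1 (u t) (ux t)); trivial.
  2: intros y Hy; apply (C1_pair_d2 _ _ _ _ _ Hu); trivial.
  2: apply (cont2_slice2 (Icc 0 T)); trivial.
  rewrite (RInt_deriv_at 0 T (fun s => u s 0) (fun s => ut s 0)); trivial.
  2: intros s Hs; apply (C1_pair_d1 _ _ _ _ _ Hu); trivial.
  2: apply (cont2_slice1 _ (Icc 0 1)); trivial.
  rewrite Hu0; ring.
- split; trivial.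
  + intros t x Ht Hx; rewrite Epx by trivial; left; auto.
  + intros t x Ht' Hx'; assert (Ht := Ioo_Icc _ _ _ Ht'); assert (Hx := Ioo_Icc _ _ _ Hx').
    assert (D1 : deriv_at (Icc 0 T) (fun s => Fj_along T H phi s x) t (- uxt t x)).
    { apply (deriv_at_ext _ (fun s => - ux s x) _ t (- uxt t x)); trivial.
      - intros s Hs; symmetry; apply EF; trivial.
      - apply deriv_at_opp, (C1_pair_d1 _ _ _ _ _ Hux); trivial. }
    (* Differentiating [u_t + phi] in place of [H(x, u_x)] brings out [u_tx], which cancels against
       the [u_xt] of [D1], and the term [m = phi_x]. *)
    assert (D2 : deriv_at (Icc 0 1) (fun y => - Fm_along T H phi t y) x (utx t x + m t x)).
    { apply (deriv_at_ext _ (fun y => ut t y + phi t y) _ x (utx t x + m t x)); trivial.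
      - intros y Hy; rewrite (proj2 (EF t y Ht Hy)), Ropp_involutive, EHJ; trivial.
      - apply deriv_at_plus.
        + apply (C1_pair_d2 _ _ _ _ _ Hut); trivial.
        + apply (C1_pair_d2 _ _ _ _ _ Cphi); trivial. }
    split; [exists (- uxt t x); apply is_derive_in_eps; trivial |].
    split; [exists (utx t x + m t x); apply is_derive_in_eps; trivial |].
    rewrite Epx by trivial.
    replace (pdt T (Fj_along T H phi) t x) with (- uxt t x)
      by (symmetry; apply deriv_at_Derive_in; trivial).
    replace (pdx (fun s y => - Fm_along T H phi s y) t x) with (utx t x + m t x)
      by (symmetry; apply deriv_at_Derive_in; trivial).
    rewrite (C1_pair_schwarz 0 T 0 1 u ut ux utt utx uxt uxx t x); trivial; lra.
  + intros t x Ht Hx Hb; destruct Hb as [-> | [-> | [-> | ->]]].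
    * rewrite phi0_initial; auto.
    * rewrite phi0_final by trivial; apply RInt_ext; intros y Hy; apply Hfin.
      unfold Icc, Rmin, Rmax in *; destruct (Rle_dec 0 x); lra.
    * rewrite phi0_left; auto.
    * rewrite phi0_right by trivial.
      (* Conservation of mass: [phi_t = w] vanishes at [x = 1], so [phi t 1] keeps its initial
         value, the integral of [m0]. *)
      transitivity (phi 0 1); [| rewrite phi_ini; trivial].
      destruct (MVT_in (Icc 0 T) (fun s => phi s 1) (fun s => w s 1) 0 t) as [c [Hc [_ E]]];
        trivial.
      -- intros s Hs; apply (C1_pair_d1 _ _ _ _ _ Cphi); trivial.
      -- rewrite (Ew c 1) in E by auto; lra.
Qed.

End Hamiltonian.

Theorem lemma2p3 (T : R) (hT : 0 < T)
  (H : R -> R -> R)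
  (hH : C1_on2 (Icc 0 1) Rall H)
  (hDpH : C1_on2 (Icc 0 1) Rall (DpH H))
  (hsuper : forall x, Icc 0 1 x ->
     is_lim (fun p => H x p / Rabs p) p_infty p_infty /\
     is_lim (fun p => H x p / Rabs p) m_infty p_infty)
  (hconv : forall x, Icc 0 1 x -> forall p : R, 0 < DppH H x p)
  (m0 mT : R -> R)
  (hm0 : C1_on (Icc 0 1) m0) (hmT : C1_on (Icc 0 1) mT)
  (hm0pos : forall x, Icc 0 1 x -> 0 < m0 x)
  (hmTpos : forall x, Icc 0 1 x -> 0 < mT x)
  (hm0int : RInt m0 0 1 = 1) (hmTint : RInt mT 0 1 = 1) :
  (forall phi : R -> R -> R,
     P2_classical T H m0 mT phi ->
     (forall t x, Icc 0 T t -> Icc 0 1 x -> 0 < pdx phi t x) ->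
     forall u m : R -> R -> R,
       relations T H phi u m -> P1_classical T H m0 mT u m)
  /\
  (forall u m : R -> R -> R,
     P1_classical T H m0 mT u m ->
     (forall t x, Icc 0 T t -> Icc 0 1 x -> 0 < m t x) ->
     u 0 0 = 0 ->
     exists phi : R -> R -> R,
       C2_on2 (Icc 0 T) (Icc 0 1) phi /\
       relations T H phi u m /\
       P2_classical T H m0 mT phi).
Proof.
split.
- intros phi Hphi Hpos u m; apply P2_to_P1; trivial.
- intros u m; apply P1_to_P2; trivial.
Qed.
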